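(* Let $F$ be a local field, let $a_1,\dots,a_n\in\mathbb Z^m$ span $\mathbb Q^m$ (so the central arrangement $\mathcal A$ is essential of rank $m$), and assume the residue characteristic of $F$ exceeds the absolute value of every minor of the $n\times m$ matrix with rows $a_i$. Then, for $\mathrm{Re}(s)>0$, $$\mathcal I_{\mathcal A}(s)=\frac{q^m-1}{q^m-q^{-s}}+\frac{1-q^s}{1-q^{-(s+m)}}\sum_{\infty=I_0\supsetneq I_1\supsetneq\dots\supsetneq I_r}q^{-(m-\mathrm{rk}(I_r))}\prod_{i=1}^r\frac{\chi_{\mathcal A^{I_i}_{I_{i-1}}}(q)}{q^{s+\delta_{I_i}}-1},$$ where the sum runs over all strictly decreasing chains of flats of length $r\ge1$ starting at $\infty$.
   Context: Local field $F$ (locally compact non-discrete totally disconnected), ring of integers $\mathcal O$, maximal ideal $\mathfrak m$, residue field $\mathbb F_q$, normalized absolute value $|\cdot|$ with $|\pi|=q^{-1}$ for a uniformizer $\pi$, $\|y\|=\max_j|y_j|$, Haar measure on $F^N$ normalized so $\mathcal O^N$ has volume $1$. The hypertoric moment map is $\mu:\mathcal O^n\times\mathcal O^n\to\mathcal O^m$, $\mu(x,y)=\sum_{i=1}^nx_iy_ia_i$, and $\mathcal I_{\mathcal A}(s)=\int_{\mathcal O^{2n}}\|\mu(x,y)\|^s\,dx\,dy$. Arrangement: $\mathcal A$ consists of the hyperplanes $H_i=\{v:\langle v,a_i\rangle=0\}$ in $F^m$. For $J\subset\{1,\dots,n\}$, $H_J=\bigcap_{i\in J}H_i$; $J$ is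 a flat if $J=\{i:H_J\subset H_i\}$; $L(\mathcal A)$ is the poset of flats under inclusion, $\infty=\{1,\dots,n\}$ (so $H_\infty=0$). $\mathrm{rk}(J)=\dim\mathrm{span}\{a_i:i\in J\}$. Möbius function: $\nu(J,J)=1$, $\sum_{J\le G\le J'}\nu(J,G)=0$ for $J<J'$. For flats $J\subseteq I$, $\mathcal A^J_I$ is the arrangement in $H_J/H_I$ of the hyperplanes $(H_i\cap H_J)/H_I$, $i\in I\setminus J$; its characteristic polynomial is $\chi_{\mathcal A^J_I}(t)=\sum_{G\in L(\mathcal A),\,J\subseteq G\subseteq I}\nu(J,G)\,t^{\dim H_G-\dim H_I}$. For a flat $I$, $\delta_I=n-|I|+\mathrm{rk}(I)$. *)

(* Defs.v *)
From HB Require Import structures.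
From mathcomp Require Import all_boot all_order all_algebra.
From mathcomp Require Import all_classical all_reals all_analysis.
From mathcomp Require Import complex.

Set Implicit Arguments.
Unset Strict Implicit.
Unset Printing Implicit Defensive.

Import Order.TTheory GRing.Theory Num.Theory.
Local Open Scope ring_scope.
Local Open Scope complex_scope.

(* Local fields.  A (non-archimedean) local field is presented through its   *)
(* normalized absolute value: a field F with an absolute value nrm : F -> R   *)
(* that is ultrametric, discretely valued with value group q^Z, normalized    *)
(* (some uniformizer pi has nrm pi = q^-1), whose residue field O/m has       *)
(* exactly q elements, and which is complete.  These are exactly the locally  *)
(* compact, non-discrete, totally disconnected fields with their normalized   *)
(* absolute value.                                                            *)
Record normalized_local_field (R : realType) (F : fieldType) (nrm : F -> R)
    (q : nat) : Prop := {
  lf_nrm0 : forall x, nrm x = 0 <-> x = 0;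
  lf_nrmM : forall x y, nrm (x * y) = nrm x * nrm y;
  lf_ultra : forall x y, nrm (x + y) <= Num.max (nrm x) (nrm y);
  lf_q_gt1 : (1 < q)%N;
  lf_value_group : forall x, x != 0 -> exists k : int, nrm x = (q%:R : R) ^ k;
  lf_uniformizer : exists pi : F, nrm pi = (q%:R : R)^-1;
  (* the residue field O/m has exactly q elements: r is a system of          *)
  (* representatives of O/m, with pairwise distinct classes                 *)
  lf_residue : exists r : 'I_q -> F,
      [/\ forall i, nrm (r i) <= 1,
          forall i j, i != j -> nrm (r i - r j) = 1 &
          forall x, nrm x <= 1 -> exists i, nrm (x - r i) < 1];
  lf_complete : forall u : nat -> F,
      (forall e : R, 0 < e -> exists N, forall k l, (N <= k)%N -> (N <= l)%N ->
          nrm (u k - u l) < e) ->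
      exists x, forall e : R, 0 < e -> exists N, forall k, (N <= k)%N ->
          nrm (u k - x) < e
}.

(* F^N as a pointed type (needed for sigma-algebra structures) *)
Definition Fv (F : fieldType) (N : nat) : Type := 'rV[F]_N.
HB.instance Definition _ (F : fieldType) (N : nat) := GRing.Zmodule.on (Fv F N).
HB.instance Definition _ (F : fieldType) (N : nat) :=
  isPointed.Build (Fv F N) 0.

Section Vectors.
Variables (R : realType) (F : fieldType) (nrm : F -> R).
Local Open Scope classical_set_scope.

Definition vnorm N (v : 'rV[F]_N) : R := \big[Num.max/0]_(j < N) nrm (v 0 j).

Definition vopen N : set (set (Fv F N)) :=
  fun U => forall x, U x -> exists2 r : R, 0 < r &
             forall y, vnorm (y - x : 'rV[F]_N) < r -> U y.

Local Notation Fvec N := (g_sigma_algebraType (@vopen N)).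

Definition intball N : set (Fvec N) := [set v | vnorm (v : 'rV[F]_N) <= 1].

Definition normalized_haar N (mu : {measure set (Fvec N) -> \bar R}) : Prop :=
  (forall (A : set (Fvec N)) (t : Fvec N), measurable A ->
      mu [set (a + t : Fvec N) | a in A] = mu A)
  /\ mu (@intball N) = 1%E.

End Vectors.
Arguments intball {R F} nrm N.
Arguments vnorm {R F} nrm {N}.

Notation Fvec nrm N := (g_sigma_algebraType (@vopen _ _ nrm N)).

Definition cpow (R : realType) (a : R) (s : R[i]) : R[i] :=
  if a == 0 then 0 else
  ((a `^ complex.Re s)%:C) *
    (cos (complex.Im s * ln a) +i* sin (complex.Im s * ln a)).

(* The pair (x, y) in O^n x O^n is z in O^(n+n) with x_i = z (lshift n i),   *)
(* y_i = z (rshift n i).  AF i j is the j-th coordinate of a_i.              *)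
Section Moment.
Variables (R : realType) (F : fieldType) (nrm : F -> R) (n m : nat).
Variable AF : 'M[F]_(n, m).

Definition moment (z : 'rV[F]_(n + n)) : 'rV[F]_m :=
  \row_(j < m) \sum_(i < n) z 0 (lshift n i) * z 0 (rshift n i) * AF i j.

Definition integrand (s : R[i]) (z : 'rV[F]_(n + n)) : R[i] :=
  cpow (vnorm nrm (moment z)) s.

Definition hypertoric_integral
    (mu : {measure set (Fvec nrm (n + n)) -> \bar R}) (s : R[i]) : R[i] :=
  (Rintegral mu (intball nrm (n + n)) (fun z => complex.Re (integrand s z)))
  +i* (Rintegral mu (intball nrm (n + n)) (fun z => complex.Im (integrand s z))).

End Moment.
Arguments hypertoric_integral {R F} nrm {n m} AF mu s.
Arguments moment {F n m} AF z.
Arguments integrand {R F} nrm {n m} AF s z.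

(* Subspaces of F^m are represented by row spaces of square matrices.       *)
Section Arrangement.
Variables (F : fieldType) (n m : nat) (AF : 'M[F]_(n, m)).

Definition rowsJ (J : {set 'I_n}) : 'M[F]_(n, m) :=
  \matrix_(i, j) (if i \in J then AF i j else 0).

(* H_J = intersection of the H_i, i in J = {v | <v, a_i> = 0 for i in J} *)
Definition Hsp (J : {set 'I_n}) : 'M[F]_m := kermx (rowsJ J)^T.

Definition dimH (J : {set 'I_n}) : nat := \rank (Hsp J).

Definition rk (J : {set 'I_n}) : nat := \rank (rowsJ J).

Definition is_flat (J : {set 'I_n}) : bool :=
  J == [set i | (Hsp J <= Hsp [set i])%MS].

Definition delta (I : {set 'I_n}) : nat := (n - #|I| + rk I)%N.

(* Moebius function of the poset of flats (ordered by inclusion):          *)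
(* nu(J,J) = 1, nu(J,J') = - sum_{J <= G < J'} nu(J,G) for J < J',         *)
(* nu(J,J') = 0 if J is not below J'.  Defined by recursion with fuel      *)
(* #|J'| (recursive calls are on proper subsets).                          *)
Fixpoint mob_fuel (k : nat) (J J' : {set 'I_n}) : int :=
  match k with
  | 0 => if J == J' then 1 else 0
  | k'.+1 =>
      if J == J' then 1
      else if J \proper J' then
        - \sum_(G : {set 'I_n} | [&& is_flat G, J \subset G & G \proper J'])
              mob_fuel k' J G
      else 0
  end.

Definition mobius (J J' : {set 'I_n}) : int := mob_fuel #|J'| J J'.

Definition charpoly_eval (R : comPzRingType) (J I : {set 'I_n}) (t : R) : R :=
  \sum_(G : {set 'I_n} | [&& is_flat G, J \subset G & G \subset I])
     (mobius J G)%:~R * t ^+ (dimH G - dimH I).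

Definition is_chain (r : nat) (c : r.-tuple {set 'I_n}) : bool :=
  all is_flat c && path (fun X Y : {set 'I_n} => Y \proper X) [set: 'I_n]%SET c.

End Arrangement.

(* minors of an integer matrix (of every size k+1 >= 1); non-injective index *)
(* maps only add zero minors or signed copies of genuine minors             *)
Definition minor (n m : nat) (A : 'M[int]_(n, m)) (k : nat)
    (f : 'I_k.+1 -> 'I_n) (g : 'I_k.+1 -> 'I_m) : int :=
  \det (\matrix_(i, j) A (f i) (g j)).

(* Main.v *)
Require Import Defs.
From HB Require Import structures.
From mathcomp Require Import all_boot all_order all_algebra.
From mathcomp Require Import all_classical all_reals all_analysis.
From mathcomp Require Import complex ring lra zify.
Set Implicit Arguments.
Unset Strict Implicit.
Unset Printing Implicit Defensive.
Import Order.TTheory GRing.Theory Num.Theory numFieldNormedType.Exports.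
Local Open Scope ring_scope.

(** With V_k the volume of {|mu| <= q^-k} and u = q^-s, the integral is
    sum_k u^k (V_k - V_{k+1}).  Linear duality over O / pi^k turns V_k into
    the probability that |x_i <v, a_i>| <= q^-k for all i, where (x, v) is uniform in
    O^n x O^m; this is obtained by counting triples (x, y, v) in two orders against a
    real function with vanishing averages over the nonzero ideals of O / pi^k, so no
    additive character is needed.  Reducing v modulo pi and sorting by the flat
    G = {i in J : <v, a_i> = 0 mod pi} gives a linear recursion
    W_{k+1}(J) = sum_{G <= J} chi(G, J) q^-delta(G) W_k(G) with V_k = q^-m W_k(oo); the
    minors being units, each solution modulo pi lifts, so the number of v modulo pi with
    flat G is q^(m - rk J) chi(G, J) by Moebius inversion.  The generating function
    sum_k u^k W_k is the fixed point of a triangular system, and solving that system by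
    descent along the poset of flats produces the sum over chains. *)

(** * Complex powers *)

(** No infinite series is summed. The chain sum is an exact solution of the fixed-point equation,
    and the K-th partial sum of u^k W_k satisfies that equation up to a term of order |u|^K; the
    integral differs from its own partial sums by its part over {|mu| <= q^-K}, again of order
    |u|^K. Quantities this close for every K are equal, and Re s > 0 gives |u| < 1.

    The function replacing a character is, for k >= 1 and up to the factor q^(k-1), the Ramanujan
    sum of psi(e b) over the units e of O / pi^k, psi being a primitive character. This sum is a
    combination of two indicator functions of ideals, so it can be written down without psi, and it
    still averages to zero over every nonzero ideal.

    The recursion sees the arrangement over the residue field, while flats, rk and chi are computed
    over F. Unit minors make the two matroids agree. *)

Section ComplexPowers.
Local Open Scope complex_scope.
Variable R : realType.
Implicit Types (a b : R) (s t : R[i]).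

Definition cexp s : R[i] :=
  (expR (complex.Re s))%:C * (cos (complex.Im s) +i* sin (complex.Im s)).

Lemma cexpD s t : cexp (s + t) = cexp s * cexp t.
Proof.
case: s t => [x y] [x' y']; rewrite /cexp /= expRD cosD sinD.
by apply/eqP; rewrite eq_complex /=; apply/andP; split; apply/eqP; ring.
Qed.

Lemma norm_cexp s : `|cexp s| = (expR (complex.Re s))%:C.
Proof.
case: s => [x y]; rewrite /cexp normc_def /=; congr (_%:C).
rewrite -[RHS]ger0_norm ?expR_ge0 // -sqrtr_sqr; congr (Num.sqrt _).
by rewrite !mul0r subr0 addr0 !exprMn -mulrDr cos2Dsin2 mulr1.
Qed.

Lemma cpowE a s : 0 < a -> cpow a s = cexp (s * (ln a)%:C).
Proof.
move=> a0; case: s => [x y]; rewrite /cpow /cexp gt_eqF //= /powR gt_eqF //.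
by rewrite !mulr0 subr0 add0r.
Qed.

Lemma cpowD a s t : 0 < a -> cpow a (s + t) = cpow a s * cpow a t.
Proof. by move=> a0; rewrite !cpowE // mulrDl cexpD. Qed.

Lemma cpowM a b s : 0 < a -> 0 < b -> cpow (a * b) s = cpow a s * cpow b s.
Proof.
move=> a0 b0; rewrite !cpowE ?mulr_gt0 // -cexpD lnM ?posrE //.
by rewrite rmorphD /= mulrDr.
Qed.

Lemma cpow1l s : cpow 1 s = 1.
Proof.
rewrite cpowE // ln1 mulr0 /cexp /= expR0 cos0 sin0.
by apply/eqP; rewrite eq_complex /= ?mulr1 ?mul0r ?subr0 ?mulr0 ?addr0 !eqxx.
Qed.

Lemma cpow0r a : 0 < a -> cpow a 0 = 1.
Proof. by move=> a0; rewrite -(cpow1l 1) !cpowE // ln1 mulr0 mul0r. Qed.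

Lemma cpowX a s k : 0 < a -> cpow (a ^+ k) s = cpow a s ^+ k.
Proof.
move=> a0; elim: k => [|k IH]; first by rewrite !expr0 cpow1l.
by rewrite !exprS cpowM ?exprn_gt0 // IH.
Qed.

Lemma cpow_inv a s : 0 < a -> cpow a^-1 s = cpow a (- s).
Proof.
move=> a0; rewrite !cpowE ?invr_gt0 // lnV ?posrE //.
by rewrite rmorphN mulrN mulNr.
Qed.

Lemma cpow_nat a k : 0 < a -> cpow a k%:R = a%:C ^+ k.
Proof.
move=> a0; rewrite cpowE //; elim: k => [|k IH].
  by rewrite mul0r expr0 -(cpow0r a0) cpowE // mul0r.
rewrite exprSr -IH -natr1 mulrDl mul1r cexpD; congr (_ * _).
rewrite /cexp /= lnK ?posrE // cos0 sin0.
by apply/eqP; rewrite eq_complex /= ?mulr1 ?mul0r ?subr0 ?mulr0 ?addr0 !eqxx.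
Qed.

Lemma cpow_neq0 a s : 0 < a -> cpow a s != 0.
Proof.
move=> a0; apply/eqP => e; have := cpow0r a0.
by rewrite -(subrr s) cpowD // e mul0r => /esym/eqP; rewrite oner_eq0.
Qed.

Lemma cpowN a s : 0 < a -> cpow a (- s) = (cpow a s)^-1.
Proof.
move=> a0; apply: (mulfI (cpow_neq0 s a0)).
by rewrite -cpowD // subrr cpow0r // divff // cpow_neq0.
Qed.

Lemma norm_cpow a s : 0 < a -> `|cpow a s| = (a `^ complex.Re s)%:C.
Proof.
move=> a0; rewrite cpowE // norm_cexp /powR gt_eqF //.
by case: s => x y /=; rewrite mulr0 subr0.
Qed.

Lemma norm_cpow_le a b s : 0 <= a -> a <= b -> 0 <= complex.Re s ->
  `|cpow a s| <= (b `^ complex.Re s)%:C.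
Proof.
move=> a0 ab s0; have [->|an0] := eqVneq a 0.
  by rewrite /cpow eqxx normr0 ler0c powR_ge0.
have a0' : 0 < a by rewrite lt_def an0.
by rewrite norm_cpow // lecR ge0_ler_powR // nnegrE (le_trans a0).
Qed.

End ComplexPowers.

(** * Norm estimates for complex numbers, and equality from geometric error bounds *)

Section ComplexBounds.
Local Open Scope complex_scope.
Variable R : realType.

Lemma norm_Im_le (z : R[i]) : `|complex.Im z|%:C <= `|z|.
Proof.
by case: z => x y; rewrite normc_def lecR /= -sqrtr_sqr ler_wsqrtr // lerDr sqr_ge0.
Qed.

Lemma normc_le_add (a b : R) : `|a +i* b| <= (`|a| + `|b|)%:C.
Proof.
rewrite normc_def lecR /= -[leRHS]ger0_norm ?addr_ge0 // -sqrtr_sqr ler_wsqrtr //.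
by rewrite sqrrD !real_normK ?num_real // addrAC lerDl mulrn_wge0 // mulr_ge0.
Qed.

Lemma sum_complexE K (x : 'I_K -> R[i]) (c : 'I_K -> R) :
  \sum_(k < K) x k * (c k)%:C =
  (\sum_(k < K) complex.Re (x k) * c k) +i* (\sum_(k < K) complex.Im (x k) * c k).
Proof.
elim: K x c => [|K IH] x c; first by rewrite !big_ord0.
rewrite !big_ord_recr /= IH; case: (x ord_max) => p q /=.
by apply/eqP; rewrite eq_complex /=; apply/andP; split; apply/eqP; ring.
Qed.

(** This takes the place of convergence of series. The order on [R[i]] relates only numbers with
    equal imaginary parts and then compares real parts, so the limit can be taken in [R]. *)
Lemma eq0_geometric_bound (z D : R[i]) (r : R) : 0 <= r < 1 ->
  (forall K, `|z| <= D * r%:C ^+ K) -> z = 0.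
Proof.
move=> /andP[r0 r1] h; apply/eqP; rewrite -normr_eq0 eq_le normr_ge0 andbT.
have hR K : complex.Re `|z| <= complex.Re D * r ^+ K.
  have e (x : R) : complex.Re (D * x%:C) = complex.Re D * x.
    by case: D {h} => a b /=; rewrite mulr0 subr0.
  by have := h K; rewrite -rmorphXn /= lecE e => /andP[].
have /cvg_geometric cv : `|r| < 1 by rewrite ger0_norm.
have : complex.Re `|z| <= 0.
  have <- : (lim (geometric (complex.Re D) r @ \oo) = 0)%classic.
    by apply/cvg_lim => //; exact: cv.
  apply: limr_ge.
    by apply/cvg_ex; exists 0; exact: cv.
  by apply: nearW => K; exact: hR.
by rewrite normc_def /= lecR.
Qed.

End ComplexBounds.

(** * Sums over chains and the resolvent of the recursion *)

Section ChainSums.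
Variables (R : realType) (n : nat) (fl : pred {set 'I_n}).
Variables (chi : {set 'I_n} -> {set 'I_n} -> R) (rho d : {set 'I_n} -> nat).
Variables (Q : R) (u : R[i]) (W : nat -> {set 'I_n} -> R).
Local Notation QC := (Q%:C)%C.
Implicit Types G J : {set 'I_n}.

Hypothesis Q_gt1 : 1 < Q.
Hypothesis u_lt1 : `|u| < 1.
Hypothesis chi_ge0 : forall G J, fl G -> fl J -> G \subset J -> 0 <= chi G J.
Hypothesis chi_diag : forall J, fl J -> chi J J = 1.
Hypothesis chi_sum : forall J, fl J ->
  \sum_(G : {set 'I_n} | fl G && (G \subset J)) chi G J / Q ^+ d G * Q ^+ rho G <= Q ^+ rho J.
Hypothesis W0 : forall J, W 0 J = Q ^+ rho J.
Hypothesis WS : forall k J, fl J ->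
  W k.+1 J = \sum_(G : {set 'I_n} | fl G && (G \subset J)) chi G J / Q ^+ d G * W k G.

Local Notation edge := (fun X Y : {set 'I_n} => Y \proper X).

(* For [u = q^-s] the second factor is [1 / (q^(s + d G) - 1)]. *)
Definition chain_weight G J : R[i] := (chi G J)%:C%C * (u / (QC ^+ d G - u)).

(** The start is an arbitrary [J] instead of infinity, so that the first link of a chain can be
    split off. The end of the chain carries [Q ^+ rho], which is the factor of the theorem
    multiplied by [q^m]. *)
Definition chain_sum_len r J : R[i] :=
  \sum_(c : r.-tuple {set 'I_n} | all fl c && path edge J c)
     (let I := fun k => nth [set: 'I_n] (J :: c) k in
      QC ^+ rho (I r) * \prod_(k < r) chain_weight (I k.+1) (I k)).

Definition chain_sum J : R[i] := \sum_(r < n.+1) chain_sum_len r J.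

Lemma chain_sum_len0 J : chain_sum_len 0 J = QC ^+ rho J.
Proof.
rewrite /chain_sum_len (big_pred1 [tuple]) /= ?big_ord0 ?mulr1 // => c.
by rewrite tuple0 /= eqxx.
Qed.

Lemma chain_sum_lenS r J :
  chain_sum_len r.+1 J =
  \sum_(G | fl G && (G \proper J)) chain_weight G J * chain_sum_len r G.
Proof.
rewrite /chain_sum_len.
pose f (p : {set 'I_n} * r.-tuple {set 'I_n}) : r.+1.-tuple {set 'I_n} := cons_tuple p.1 p.2.
rewrite (reindex f) /=; last first.
  exists (fun c => (thead c, behead_tuple c)).
    by move=> [G c] _; congr (_, _); exact/val_inj.
  by move=> c _; rewrite [RHS]tuple_eta; exact: val_inj.
under [RHS]eq_bigr do rewrite mulr_sumr.
rewrite pair_big_dep /=; apply: eq_big => [[G c]|[G c] _] /=.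
  by rewrite andbACA.
rewrite big_ord_recl /= mulrCA; congr (_ * (_ * _)).
Qed.

(** Every link loses an element, so cutting chains off at length [n] loses nothing. *)
Lemma chain_sum_len_eq0 r J : (#|J| < r)%N -> chain_sum_len r J = 0.
Proof.
elim: r J => [//|r IH] J hJ; rewrite chain_sum_lenS big1 // => G /andP[_ /proper_card GJ].
by rewrite IH ?mulr0 // (leq_trans GJ).
Qed.

Lemma chain_sumE J : chain_sum J =
  QC ^+ rho J + \sum_(G | fl G && (G \proper J)) chain_weight G J * chain_sum G.
Proof.
rewrite /chain_sum big_ord_recl chain_sum_len0; congr (_ + _).
under eq_bigr do rewrite chain_sum_lenS.
rewrite exchange_big; apply: eq_bigr => G /andP[_ GJ] /=.
rewrite -mulr_sumr big_ord_recr /= [chain_sum_len n G]chain_sum_len_eq0 ?addr0 //.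
rewrite (leq_trans (proper_card GJ)) //.
by have := max_card J; rewrite card_ord.
Qed.

Lemma Qpow_neq_u k : QC ^+ k - u != 0.
Proof.
rewrite subr_eq0; apply: contraTneq u_lt1 => <-.
by rewrite -rmorphXn normc_def /= expr0n addr0 sqrtr_sqr ltcR ltNge
  ger0_norm ?exprn_ge0 ?exprn_ege1 ?ltW // (lt_trans ltr01).
Qed.

Lemma QC_neq0 k : QC ^+ k != 0.
Proof. by rewrite -rmorphXn fmorph_eq0 expf_neq0 // gt_eqF // (lt_trans ltr01). Qed.

(** The intended value of sum_k u^k W_k(J). The denominator accounts for the diagonal term [G = J]
    of the recursion; [chain_sum] collects the descents to smaller flats. *)
Definition resolvent J : R[i] := chain_sum J / (1 - u / QC ^+ d J).

Lemma resolventE J : fl J -> resolvent J =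
  QC ^+ rho J + u * \sum_(G | fl G && (G \subset J)) (chi G J / Q ^+ d G)%:C%C * resolvent G.
Proof.
move=> fJ.
have hd k : 1 - u / QC ^+ k != 0.
  have -> : 1 - u / QC ^+ k = (QC ^+ k - u) / QC ^+ k by rewrite mulrBl divff ?QC_neq0.
  by rewrite mulf_neq0 ?invr_eq0 ?QC_neq0 ?Qpow_neq_u.
rewrite (bigD1 J) /=; last by rewrite fJ fintype.subxx.
rewrite chi_diag // mulrDr mulr_sumr.
(* The denominator of [resolvent G] turns the coefficient u chi / Q^d into [chain_weight]. *)
under eq_bigr => G hG.
  have -> : u * ((chi G J / Q ^+ d G)%:C%C * resolvent G) = chain_weight G J * chain_sum G.
    rewrite /resolvent /chain_weight rmorphM fmorphV rmorphXn /=.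
    by field; rewrite ?Qpow_neq_u ?QC_neq0 ?hd.
  over.
rewrite (eq_bigl (fun G => fl G && (G \proper J))) => [|G]; last first.
  by rewrite finset.properEneq -andbA [(G != J) && _]andbC.
rewrite addrCA -chain_sumE {1}/resolvent /resolvent.
rewrite rmorphM fmorphV rmorphXn rmorph1 /=.
by field; rewrite ?Qpow_neq_u ?QC_neq0 ?hd.
Qed.

(** The resolvent and the partial sums obey the same affine recursion, so their difference obeys the
    linear one. By [chi_sum] the weight [Q ^+ rho] does not grow under its nonnegative coefficients,
    and each pass gains a factor |u|. *)
Lemma resolvent_approx J K : fl J ->
  `|resolvent J - \sum_(k < K) u ^+ k * (W k J)%:C%C|
  <= (\sum_G `|resolvent G|) * `|u| ^+ K * QC ^+ rho J.
Proof.
set B := \sum_G `|resolvent G|.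
have QCE k : QC ^+ k = (Q ^+ k)%:C%C by rewrite rmorphXn.
elim: K J => [|K IH] J fJ.
  rewrite big_ord0 subr0 expr0 mulr1; apply: (@le_trans _ _ B).
    by rewrite /B (bigD1 J) //= lerDl sumr_ge0.
  by rewrite ler_peMr ?sumr_ge0 // QCE -[1]/(1%:C%C) lecR exprn_ege1 // ltW.
have -> : resolvent J - \sum_(k < K.+1) u ^+ k * (W k J)%:C%C =
   u * \sum_(G | fl G && (G \subset J)) (chi G J / Q ^+ d G)%:C%C *
      (resolvent G - \sum_(k < K) u ^+ k * (W k G)%:C%C).
  rewrite resolventE // big_ord_recl W0 expr0 mul1r -QCE opprD addrA.
  rewrite (addrC (QC ^+ _)) addrK.
  under [X in _ - X]eq_bigr do rewrite lift0 exprS WS // -mulrA rmorph_sum /=.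
  rewrite -mulr_sumr -mulrBr; congr (_ * _).
  under [X in _ - X]eq_bigr do rewrite mulr_sumr.
  rewrite exchange_big -sumrB; apply: eq_bigr => G _.
  rewrite mulrBr mulr_sumr; congr (_ - _); apply: eq_bigr => k _.
  by rewrite rmorphM mulrCA.
rewrite normrM exprS -mulrA mulrCA -!mulrA ler_wpM2l //.
apply: le_trans (ler_norm_sum _ _ _) _.
apply: (@le_trans _ _ (\sum_(G | fl G && (G \subset J))
   (chi G J / Q ^+ d G * Q ^+ rho G)%:C%C * (B * `|u| ^+ K))).
  apply: ler_sum => G /andP[fG GJ].
  have h0 : 0 <= chi G J / Q ^+ d G.
    by rewrite divr_ge0 ?chi_ge0 ?exprn_ge0 // ltW // (lt_trans ltr01).
  set a := chi G J / Q ^+ d G in h0 *.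
  rewrite normrM ger0_norm ?ler0c // [(a * Q ^+ rho G)%:C%C]rmorphM /= -mulrA ler_wpM2l ?ler0c //.
  by rewrite mulrC -QCE; apply: IH.
rewrite -mulr_suml -rmorph_sum /= (mulrC B) [leRHS]mulrA [leRHS]mulrC.
by rewrite ler_wpM2r ?mulr_ge0 ?exprn_ge0 ?sumr_ge0 // QCE lecR chi_sum.
Qed.
End ChainSums.

(** * Integrals of functions that are constant on shells *)

Section ShellIntegral.
Local Open Scope classical_set_scope.
Context {disp : measure_display} {T : measurableType disp} {R : realType}.
Variables (mu : {measure set T -> \bar R}) (E : nat -> set T) (v b M : nat -> R) (g : T -> R).
Hypothesis mE : forall k, measurable (E k).
Hypothesis EV : forall k, mu (E k) = (v k)%:E.
Hypothesis ES : forall k, E k.+1 `<=` E k.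
Hypothesis gb : forall k x, E k x -> ~ E k.+1 x -> g x = b k.
Hypothesis g0 : forall x, (forall k, E k x) -> g x = 0.
Hypothesis gM : forall k x, E k x -> `|g x| <= M k.

Lemma shell_sub k : E k `<=` E 0.
Proof. by elim: k => [//|k IH] x /ES/IH. Qed.

(** [g] is constant on countably many measurable pieces: the shells, and the intersection of all
    [E k]. *)
Lemma shell_measurable_fun : measurable_fun (E 0) g.
Proof.
pose G i := if i is i'.+1 then E i' `\` E i'.+1 else \bigcap_k E k.
have mG i : measurable (G i).
  case: i => [|i] /=; first exact: bigcapT_measurable.
  exact: measurableD.
have -> : E 0 = \bigcup_i G i.
  apply/seteqP; split => x.
    move=> E0; have [h|/existsNP[k hk]] := pselect (forall k, E k x).
      by exists 0%N => // k _; exact: h.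
    suff [j Ej] : exists j, E j x /\ ~ E j.+1 x by exists j.+1.
    elim: k hk => [//|k IH] hk; have [Ek|/IH//] := pselect (E k x).
    by exists k.
  by case=> -[|i] _ /=; [apply|case=> /shell_sub].
apply/measurable_fun_bigcup => // -[|i].
  apply: (eq_measurable_fun (cst (0 : R))); last exact: measurable_cst.
  by move=> x /set_mem h; rewrite g0 // => k; exact: h.
apply: (eq_measurable_fun (cst (b i))); last exact: measurable_cst.
by move=> x /set_mem[h1 h2]; rewrite (gb h1 h2).
Qed.

Lemma shell_integrable k : mu.-integrable (E k) (EFin \o g).
Proof.
apply: (integrableS (mE 0) (mE k) (@shell_sub k)).
apply: measurable_bounded_integrable => //.
- by rewrite EV ltry.
- exact: shell_measurable_fun.
exists (M 0); split; first exact: num_real.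
by move=> y /ltW hy x /gM h; exact: le_trans hy.
Qed.

(** Removing the shells one at a time leaves exactly the integral over [E K], where [M K] bounds the
    integrand. *)
Lemma shell_integral_approx K :
  `|Rintegral mu (E 0) g - \sum_(k < K) b k * (v k - v k.+1)| <= M K * v K.
Proof.
have -> : Rintegral mu (E 0) g - \sum_(k < K) b k * (v k - v k.+1) = Rintegral mu (E K) g.
  elim: K => [|K IH]; first by rewrite big_ord0 subr0.
  rewrite big_ord_recr /= opprD addrA IH.
  have EU : E K = (E K `\` E K.+1) `|` E K.+1 by rewrite setUC setDUK.
  rewrite [X in Rintegral mu X]EU Rintegral_setU //; first last.
  - by apply/disj_set2P; rewrite setDE -setIA setICl setI0.
  - by rewrite -EU; exact: shell_integrable.
  - exact: measurableD.
  rewrite (@eq_Rintegral _ _ _ mu _ (cst (b K))); last first.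
    by move=> x /set_mem[h1 h2]; rewrite (gb h1 h2).
  rewrite Rintegral_cst; last exact: measurableD.
  have -> : fine (mu (E K `\` E K.+1)) = v K - v K.+1.
    have -> : mu (E K `\` E K.+1) = (mu (E K) - mu (E K `&` E K.+1))%E.
      by apply: measureD => //; rewrite [ltLHS]EV ltry.
    rewrite (_ : E K `&` E K.+1 = E K.+1); last exact/setIidr/ES.
    by rewrite !EV.
  by rewrite addrAC subrr add0r.
apply: le_trans (le_normr_Rintegral _ _) _; [exact: mE|exact: shell_integrable|].
have -> : M K * v K = Rintegral mu (E K) (fun=> M K) by rewrite (Rintegral_cst mu (mE K)) EV.
apply: le_Rintegral => //.
- exact: (integrable_norm (shell_integrable K)).
- apply: measurable_bounded_integrable => //; first by rewrite EV ltry.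
  exact: bounded_cst.
- by move=> x /gM.
Qed.
End ShellIntegral.

(** * Flats and the Moebius function *)

Section Flats.
Variables (F : fieldType) (n m : nat) (AF : 'M[F]_(n, m)).
Implicit Types G H J K : {set 'I_n}.

Lemma sub_Hsp (v : 'rV[F]_m) J :
  (v <= Hsp AF J)%MS = [forall i in J, (v *m AF^T) 0 i == 0].
Proof.
have E i : (v *m (rowsJ AF J)^T) 0 i = if i \in J then (v *m AF^T) 0 i else 0.
  rewrite !mxE; case: ifP => iJ; last by rewrite big1 // => j _; rewrite !mxE iJ mulr0.
  by apply: eq_bigr => j _; rewrite !mxE iJ.
apply/sub_kermxP/forall_inP => [/rowP h i iJ|h].
  by apply/eqP; have := h i; rewrite E iJ [RHS]mxE.
by apply/rowP => i; rewrite E [RHS]mxE; case: ifP => // /h/eqP.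
Qed.

Lemma Hsp_subP J K :
  reflect (forall v : 'rV[F]_m, (forall i, i \in J -> (v *m AF^T) 0 i = 0) ->
             forall i, i \in K -> (v *m AF^T) 0 i = 0)
          (Hsp AF J <= Hsp AF K)%MS.
Proof.
apply: (iffP rV_subP) => [h v hv i iK|h v].
  have : (v <= Hsp AF J)%MS by rewrite sub_Hsp; apply/forall_inP => j /hv ->.
  by move/h; rewrite sub_Hsp => /forall_inP/(_ i iK)/eqP.
rewrite !sub_Hsp => /forall_inP hv; apply/forall_inP => i iK.
by apply/eqP/(h v) => // j /hv/eqP.
Qed.

Lemma Hsp_anti J K : J \subset K -> (Hsp AF K <= Hsp AF J)%MS.
Proof. by move=> /fintype.subsetP JK; apply/Hsp_subP => v hv i /JK/hv. Qed.

Lemma dimHE J : dimH AF J = (m - rk AF J)%N.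
Proof. by rewrite /dimH mxrank_ker mxrank_tr. Qed.

Lemma rk_le J : (rk AF J <= m)%N.
Proof. exact: rank_leq_col. Qed.

Lemma rk_mono J K : J \subset K -> (rk AF J <= rk AF K)%N.
Proof.
move=> /Hsp_anti/mxrankS; rewrite -!/(dimH AF _) !dimHE.
by have := rk_le J; have := rk_le K; lia.
Qed.

Lemma is_flatP J : is_flat AF J ->
  forall i, (forall v : 'rV[F]_m, (forall j, j \in J -> (v *m AF^T) 0 j = 0) ->
     (v *m AF^T) 0 i = 0) -> i \in J.
Proof.
move=> fJ i hi; rewrite (eqP fJ) inE.
by apply/Hsp_subP => v hv j /set1P ->; exact: hi.
Qed.

Lemma flatI J : (forall i, (forall v : 'rV[F]_m, (forall j, j \in J -> (v *m AF^T) 0 j = 0) ->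
     (v *m AF^T) 0 i = 0) -> i \in J) -> is_flat AF J.
Proof.
move=> h; apply/eqP/setP => i; rewrite inE; apply/idP/Hsp_subP => [iJ v hv j|hi].
  by move/set1P ->; exact: hv.
by apply: h => v /hi/(_ i (finset.set11 i)).
Qed.

Lemma flatT : is_flat AF [set: 'I_n].
Proof. by apply: flatI => i _; rewrite inE. Qed.

(** Recursive calls go to proper subsets, so extra fuel changes nothing. This reconciles [mobius],
    whose fuel depends on its second argument, with the common fuel inside the recursive sum. *)
Lemma mob_fuelE k k' J H : (#|H| <= k)%N -> (#|H| <= k')%N ->
  mob_fuel AF k J H = mob_fuel AF k' J H.
Proof.
elim: k k' H => [|k IH] [|k'] H //=.
- rewrite leqn0 cards_eq0 => /eqP -> _; rewrite properE finset.sub0set andbF.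
  by case: eqP.
- move=> _; rewrite leqn0 cards_eq0 => /eqP ->; rewrite properE finset.sub0set andbF.
  by case: eqP.
- move=> hk hk'; case: eqP => // _; case: ifP => // _; congr (- _).
  apply: eq_bigr => G /and3P[_ _ /proper_card GH].
  by apply: IH; rewrite -ltnS (leq_trans GH).
Qed.

Lemma mobius_sum J K : is_flat AF J -> is_flat AF K -> J \subset K ->
  \sum_(G : {set 'I_n} | [&& is_flat AF G, J \subset G & G \subset K]) mobius AF J G
  = (J == K)%:R.
Proof.
move=> fJ fK JK; have [<-|nJK] := eqVneq J K.
  rewrite (big_pred1 J) => [|G].
    by rewrite /mobius; case: #|J| => [|k] /=; rewrite eqxx.
  rewrite /= -finset.eqEsubset [G == J]eq_sym.
  by case: eqP => [<-|]; rewrite ?andbF ?fJ.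
rewrite (bigD1 K) /=; last by rewrite fK JK /=.
have pJK : J \proper K by rewrite finset.properEneq nJK.
have : (0 < #|K|)%N by rewrite (leq_ltn_trans _ (proper_card pJK)).
case EK: #|K| => [//|k] _.
rewrite {1}/mobius EK /= (negbTE nJK) pJK addrC; apply/eqP; rewrite subr_eq0; apply/eqP.
apply: eq_big => [G|G /andP[/and3P[_ _ GK] nGK]].
  by rewrite finset.properEneq -!andbA [(G != K) && _]andbC.
apply: mob_fuelE => //; rewrite -ltnS -EK proper_card //.
by rewrite finset.properEneq nGK.
Qed.

End Flats.

Lemma charpoly_diag (F : fieldType) (n m : nat) (AF : 'M[F]_(n, m)) (S : comPzRingType) J (t : S) :
  is_flat AF J -> charpoly_eval AF J J t = 1.
Proof.
move=> fJ; rewrite /charpoly_eval (big_pred1 J) => [|G].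
  rewrite subnn expr0 mulr1 /mobius.
  by case: #|J| => [|k] /=; rewrite eqxx mulr1z.
rewrite /= -finset.eqEsubset [G == J]eq_sym.
by case: eqP => [<-|]; rewrite ?andbF ?fJ.
Qed.

(** * Local fields and representatives modulo powers of the uniformizer *)

Section AbsoluteValue.
Variables (R : realType) (F : fieldType) (nrm : F -> R) (q : nat).
Hypothesis lf : normalized_local_field nrm q.
Local Notation Q := (q%:R : R).

Lemma lf_Q_gt1 : 1 < Q.
Proof. by rewrite ltr1n; exact: lf_q_gt1 lf. Qed.

Lemma lf_Q_gt0 : 0 < Q.
Proof. exact: lt_trans ltr01 lf_Q_gt1. Qed.

Lemma lf_Q_neq0 : Q != 0.
Proof. by rewrite gt_eqF // lf_Q_gt0. Qed.

Lemma nrm0 : nrm 0 = 0.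
Proof. exact/(lf_nrm0 lf). Qed.

Lemma nrm_gt0 x : x != 0 -> 0 < nrm x.
Proof.
by move=> /(lf_value_group lf)[k ->]; rewrite exprz_gt0 // lf_Q_gt0.
Qed.

Lemma nrm_ge0 x : 0 <= nrm x.
Proof. by have [->|/nrm_gt0/ltW//] := eqVneq x 0; rewrite nrm0. Qed.

Lemma nrm1 : nrm 1 = 1.
Proof.
have h : nrm 1 != 0 by rewrite gt_eqF // nrm_gt0 ?oner_neq0.
by apply: (mulfI h); rewrite -(lf_nrmM lf) !mulr1.
Qed.

Lemma nrmN x : nrm (- x) = nrm x.
Proof.
suff h : nrm (-1) = 1 by rewrite -mulN1r (lf_nrmM lf) h mul1r.
have : nrm (-1) ^+ 2 = 1 by rewrite expr2 -(lf_nrmM lf) mulrNN mulr1 nrm1.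
move/eqP; rewrite sqrf_eq1 => /orP[/eqP//|/eqP h].
by have := nrm_ge0 (-1); rewrite h ler0N1.
Qed.

Lemma nrmX x k : nrm (x ^+ k) = nrm x ^+ k.
Proof.
by elim: k => [|k IH]; rewrite ?expr0 ?nrm1 // !exprS (lf_nrmM lf) IH.
Qed.

Lemma nrmV x : nrm x^-1 = (nrm x)^-1.
Proof.
have [->|x0] := eqVneq x 0; first by rewrite invr0 nrm0 invr0.
have h : nrm x != 0 by rewrite gt_eqF // nrm_gt0.
by apply: (mulfI h); rewrite -(lf_nrmM lf) !divff // nrm1.
Qed.

Lemma nrmD_le e x y : nrm x <= e -> nrm y <= e -> nrm (x + y) <= e.
Proof. by move=> hx hy; rewrite (le_trans (lf_ultra lf x y)) // ge_max hx. Qed.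

Lemma nrmB_le e x y : nrm x <= e -> nrm y <= e -> nrm (x - y) <= e.
Proof. by move=> hx hy; rewrite nrmD_le ?nrmN. Qed.

Lemma nrmD_lt e x y : nrm x < e -> nrm y < e -> nrm (x + y) < e.
Proof. by move=> hx hy; rewrite (le_lt_trans (lf_ultra lf x y)) // gt_max hx. Qed.

Lemma nrmM_le1 x y : nrm x <= 1 -> nrm y <= 1 -> nrm (x * y) <= 1.
Proof. by move=> hx hy; rewrite (lf_nrmM lf) mulr_ile1 ?nrm_ge0. Qed.

Lemma nrm_sum_le (I : Type) (s : seq I) (P : pred I) (f : I -> F) e :
  0 <= e -> (forall i, P i -> nrm (f i) <= e) -> nrm (\sum_(i <- s | P i) f i) <= e.
Proof.
move=> e0 h; elim/big_rec: _ => [|i x Pi hx]; first by rewrite nrm0.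
by rewrite nrmD_le ?h.
Qed.

Lemma nrm_addr_le e x y : nrm y <= e -> (nrm (x + y) <= e) = (nrm x <= e).
Proof.
move=> hy; apply/idP/idP => h; last exact: nrmD_le.
by rewrite -(addrK y x) nrmB_le.
Qed.

Lemma nrm_addr_lt e x y : nrm y < e -> (nrm (x + y) < e) = (nrm x < e).
Proof.
move=> hy; apply/idP/idP => h; last exact: nrmD_lt.
by rewrite -(addrK y x) nrmD_lt // nrmN.
Qed.

Lemma nrm_nat_le1 k : nrm k%:R <= 1.
Proof.
elim: k => [|k IH]; first by rewrite nrm0 ler01.
by rewrite -addn1 natrD nrmD_le ?nrm1.
Qed.

Lemma nrm_int_le1 (z : int) : nrm z%:~R <= 1.
Proof.
case: z => k; first exact: nrm_nat_le1.
by rewrite NegzE mulrNz nrmN; exact: nrm_nat_le1.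
Qed.

Lemma nrm_discrete x k : (nrm x < Q ^- k) = (nrm x <= Q ^- k.+1).
Proof.
have [->|x0] := eqVneq x 0.
  by rewrite nrm0 !invr_gt0 !exprn_gt0 ?invr_ge0 ?exprn_ge0 ?ltW ?lf_Q_gt0.
have [z ->] := lf_value_group lf x0.
rewrite !exprnN ltr_eXz2l ?ler_eXz2l ?lf_Q_gt1 //.
lia.
Qed.

Lemma nrm_lt1 x : (nrm x < 1) = (nrm x <= Q^-1).
Proof. by have := nrm_discrete x 0; rewrite expr0 invr1 expr1. Qed.

End AbsoluteValue.

Section Representatives.
Variables (R : realType) (F : fieldType) (nrm : F -> R) (q : nat).
Hypothesis lf : normalized_local_field nrm q.
Local Notation Q := (q%:R : R).

Variables (pi : F) (r : 'I_q -> F) (red : F -> 'I_q).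
Hypothesis nrm_pi : nrm pi = Q^-1.
Hypothesis r_le1 : forall i, nrm (r i) <= 1.
Hypothesis r_lt1 : forall i, nrm (r i) < 1 -> r i = 0.
Hypothesis r_sep : forall i j, i != j -> nrm (r i - r j) = 1.
Hypothesis redP : forall x, nrm x <= 1 -> nrm (x - r (red x)) < 1.

Lemma uniformizer_neq0 : pi != 0.
Proof.
apply/eqP => h; move: nrm_pi; rewrite h (nrm0 lf) => /esym/eqP.
by rewrite invr_eq0 (negbTE (lf_Q_neq0 lf)).
Qed.

Lemma nrm_piX k : nrm (pi ^+ k) = Q ^- k.
Proof. by rewrite (nrmX lf) nrm_pi exprVn. Qed.

Lemma nrm_pi_mul_le x k : (nrm (pi * x) <= Q ^- k.+1) = (nrm x <= Q ^- k).
Proof.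
rewrite (lf_nrmM lf) nrm_pi exprS invfM ler_pM2l //.
by rewrite invr_gt0 (lf_Q_gt0 lf).
Qed.

Lemma nrm_pi_mul_lt1 x : (nrm (pi * x) < 1) = (nrm x <= 1).
Proof. by have := nrm_pi_mul_le x 0; rewrite expr0 invr1 expr1 (nrm_lt1 lf). Qed.

Lemma nrm_piX_mul_le x k : (nrm (pi ^+ k * x) <= Q ^- k) = (nrm x <= 1).
Proof.
rewrite (lf_nrmM lf) nrm_piX ger_pMr // invr_gt0 exprn_gt0 //.
by rewrite (lf_Q_gt0 lf).
Qed.

Lemma Qinv_lt1 : Q^-1 < 1.
Proof. by rewrite invf_lt1 ?(lf_Q_gt0 lf) ?(lf_Q_gt1 lf). Qed.

Lemma QinvX_le1 k : Q ^- k <= 1.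
Proof.
by rewrite -exprVn exprn_ile1 // ?invr_ge0 ?ltW ?Qinv_lt1 ?(lf_Q_gt0 lf).
Qed.

Lemma QinvX_ge0 k : 0 <= Q ^- k.
Proof. by rewrite invr_ge0 exprn_ge0 // ltW // (lf_Q_gt0 lf). Qed.

Lemma r_inj i j : nrm (r i - r j) < 1 -> i = j.
Proof. by move=> h; apply/eqP; apply: contraTT h => /r_sep ->; rewrite ltxx. Qed.

Lemma red_uniq x i : nrm x <= 1 -> nrm (x - r i) < 1 -> i = red x.
Proof.
move=> hx hi; apply: r_inj.
have -> : r i - r (red x) = - (x - r i) + (x - r (red x)) by ring.
by rewrite (nrmD_lt lf) ?(nrmN lf) ?redP.
Qed.

Lemma red_lt1E x i : nrm x <= 1 -> (nrm (x - r i) < 1) = (i == red x).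
Proof.
move=> hx; apply/idP/eqP => [|->]; [exact: red_uniq|exact: redP].
Qed.

Definition intv N (v : 'rV[F]_N) := [forall j, nrm (v 0 j) <= 1].

Lemma intvP N (v : 'rV[F]_N) : reflect (forall j, nrm (v 0 j) <= 1) (intv v).
Proof. exact: forallP. Qed.

Lemma intvD N (v w : 'rV[F]_N) : intv v -> intv w -> intv (v + w).
Proof.
move=> /intvP hv /intvP hw; apply/intvP => j; rewrite mxE.
exact: (nrmD_le lf).
Qed.

Lemma intvZ N a (v : 'rV[F]_N) : nrm a <= 1 -> intv v -> intv (a *: v).
Proof.
move=> ha /intvP hv; apply/intvP => j; rewrite mxE.
exact: (nrmM_le1 lf).
Qed.

Lemma intv_pi N (v : 'rV[F]_N) : intv v -> intv (pi *: v).
Proof. by apply: intvZ; rewrite nrm_pi ltW // Qinv_lt1. Qed.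

Lemma intv_piX N k (v : 'rV[F]_N) : intv v -> intv (pi ^+ k *: v).
Proof. by apply: intvZ; rewrite nrm_piX QinvX_le1. Qed.

Lemma intv0 N : intv (0 : 'rV[F]_N).
Proof. by apply/intvP => j; rewrite mxE (nrm0 lf) ler01. Qed.

Definition rvec N (t : {ffun 'I_N -> 'I_q}) : 'rV[F]_N := \row_j r (t j).

Lemma intv_rvec N (t : {ffun 'I_N -> 'I_q}) : intv (rvec t).
Proof. by apply/intvP => j; rewrite mxE. Qed.

Lemma intv_divpi N (v : 'rV[F]_N) :
  (forall j, nrm (v 0 j) < 1) -> exists2 w, intv w & v = pi *: w.
Proof.
move=> h; exists (pi^-1 *: v); last by rewrite scalerA divff ?scale1r ?uniformizer_neq0.
apply/intvP => j; rewrite mxE (lf_nrmM lf) (nrmV lf) nrm_pi invrK.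
rewrite mulrC -ler_pdivlMr ?(lf_Q_gt0 lf) // mul1r -(nrm_lt1 lf).
exact: h.
Qed.

Definition redv N (v : 'rV[F]_N) : {ffun 'I_N -> 'I_q} := [ffun j => red (v 0 j)].

Lemma redvP N (v : 'rV[F]_N) : intv v ->
  exists2 w, intv w & v = rvec (redv v) + pi *: w.
Proof.
move=> /intvP hv.
have [j|w hw e] := @intv_divpi _ (v - rvec (redv v)).
  by rewrite !mxE ffunE redP.
by exists w => //; rewrite -e addrC subrK.
Qed.

Lemma redv_uniq N (v w : 'rV[F]_N) t : intv v -> intv w ->
  v = rvec t + pi *: w -> t = redv v.
Proof.
move=> /intvP hv /intvP hw e; apply/ffunP => j; rewrite ffunE.
apply: red_uniq => //; by rewrite {1}e !mxE addrAC subrr add0r nrm_pi_mul_lt1.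
Qed.

Lemma redv_shift_inj N (w : 'rV[F]_N) : intv w -> injective (fun t => redv (rvec t + w)).
Proof.
move=> hw t t' /ffunP e; apply/ffunP => j; apply: r_inj.
have ht u : nrm (r (u j) + w 0 j) <= 1.
  by rewrite (nrmD_le lf) //; exact/intvP.
have := e j; rewrite !ffunE !mxE => ej.
have -> : r (t j) - r (t' j) = (r (t j) + w 0 j - r (red (r (t j) + w 0 j)))
    + - (r (t' j) + w 0 j - r (red (r (t' j) + w 0 j))) by rewrite ej; ring.
by rewrite (nrmD_lt lf) ?(nrmN lf) ?redP.
Qed.

(** Digit expansions representing (O / pi^k)^N. The residue digit is outermost, so that [sum_repsS]
    sorts a sum by reduction modulo [pi]. *)
Fixpoint reps k N : seq 'rV[F]_N :=
  if k is k'.+1 then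
    [seq rvec t + pi *: v | t <- enum {ffun 'I_N -> 'I_q}, v <- reps k' N]
  else [:: 0].

Lemma sum_reps0 (V : nmodType) N (f : 'rV[F]_N -> V) :
  \sum_(v <- reps 0 N) f v = f 0.
Proof. by rewrite big_seq1. Qed.

Lemma sum_repsS (V : nmodType) k N (f : 'rV[F]_N -> V) :
  \sum_(v <- reps k.+1 N) f v =
  \sum_(t : {ffun 'I_N -> 'I_q}) \sum_(v <- reps k N) f (rvec t + pi *: v).
Proof. by rewrite big_allpairs_dep big_enum. Qed.

Lemma reps_int k N v : v \in reps k N -> intv v.
Proof.
elim: k v => [|k IH] v; first by rewrite inE => /eqP ->; exact: intv0.
case/allpairsP => -[t w] /= [_ /IH hw ->].
by rewrite intvD ?intv_rvec ?intv_pi.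
Qed.

Lemma size_reps k N : size (reps k N) = (q ^ (N * k))%N.
Proof.
elim: k => [|k IH]; first by rewrite muln0.
by rewrite size_allpairs IH -cardT card_ffun !card_ord -expnD mulnS.
Qed.

Lemma sum_reps_const k N (a : R) : \sum_(v <- reps k N) a = Q ^+ (N * k) * a.
Proof. by rewrite big_const_seq count_predT iter_addr_0 size_reps -natrX mulr_natl. Qed.

Definition invmod (T : Type) k N (f : 'rV[F]_N -> T) :=
  forall v w, intv v -> intv w -> f (v + pi ^+ k *: w) = f v.

Lemma invmodS T k N (f : 'rV[F]_N -> T) w : intv w -> invmod k.+1 f ->
  invmod k (fun v => f (w + pi *: v)).
Proof.
move=> hw hf v v' hv hv'.
by rewrite scalerDr scalerA -exprS addrA hf // intvD // intv_pi.
Qed.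

Lemma sum_reps_translate (V : nmodType) k N (f : 'rV[F]_N -> V) w :
  intv w -> invmod k f ->
  \sum_(v <- reps k N) f (v + w) = \sum_(v <- reps k N) f v.
Proof.
elim: k f w => [|k IH] f w hw hf.
  by rewrite !sum_reps0; have := hf 0 w (intv0 N) hw; rewrite expr0 scale1r.
rewrite !sum_repsS.
rewrite [RHS](reindex_inj (redv_shift_inj hw)) /=; apply: eq_bigr => t _.
have htw : intv (rvec t + w) by rewrite intvD ?intv_rvec.
(* [w'] is the carry of the addition of digits; the induction hypothesis absorbs it. *)
have [w' hw' e] := redvP htw.
rewrite -[RHS](IH _ w') //; last by apply: invmodS => //; exact: intv_rvec.
apply: eq_bigr => v _; congr f.
by rewrite addrAC {1}e -addrA (addrC (pi *: w')) scalerDr.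
Qed.

Lemma sum_reps_coarsen k N (f : 'rV[F]_N -> R) : invmod k f ->
  \sum_(v <- reps k.+1 N) f v = Q ^+ N * \sum_(v <- reps k N) f v.
Proof.
elim: k f => [|k IH] f hf.
  rewrite sum_repsS sum_reps0 (eq_bigr (fun=> f 0)) => [|t _].
    by rewrite sumr_const card_ffun !card_ord -natrX mulr_natl.
  have := hf 0 (rvec t) (intv0 N) (intv_rvec t).
  by rewrite sum_reps0 scaler0 addr0 expr0 scale1r add0r.
rewrite sum_repsS (sum_repsS k) mulr_sumr; apply: eq_bigr => t _.
by rewrite IH //; apply: invmodS => //; exact: intv_rvec.
Qed.

Lemma rvec_row_mx N1 N2 (t : {ffun 'I_(N1 + N2) -> 'I_q}) :
  rvec t = row_mx (rvec [ffun i => t (lshift N2 i)]) (rvec [ffun i => t (rshift N1 i)]).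
Proof.
apply/rowP => j; rewrite !mxE; case: splitP => i e; rewrite mxE ffunE;
  congr (r (t _)); exact/val_inj.
Qed.

Lemma sum_ffun_split (V : nmodType) N1 N2
    (h : {ffun 'I_N1 -> 'I_q} -> {ffun 'I_N2 -> 'I_q} -> V) :
  \sum_(t : {ffun 'I_(N1 + N2) -> 'I_q})
     h [ffun i => t (lshift N2 i)] [ffun i => t (rshift N1 i)] =
  \sum_t1 \sum_t2 h t1 t2.
Proof.
rewrite pair_big /=.
pose g (p : {ffun 'I_N1 -> 'I_q} * {ffun 'I_N2 -> 'I_q}) : {ffun 'I_(N1 + N2) -> 'I_q} :=
  [ffun i => match fintype.split i with inl a => p.1 a | inr b => p.2 b end].
rewrite (reindex g) /=.
  apply: eq_bigr => -[t1 t2] _; congr (h _ _); apply/ffunP => i; rewrite !ffunE.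
    by rewrite (unsplitK (inl _)).
  by rewrite (unsplitK (inr _)).
exists (fun t => ([ffun i => t (lshift N2 i)], [ffun i => t (rshift N1 i)])).
  move=> [t1 t2] _; congr (_, _); apply/ffunP => i; rewrite !ffunE.
    by rewrite (unsplitK (inl _)).
  by rewrite (unsplitK (inr _)).
move=> t _; apply/ffunP => i; rewrite ffunE -[in RHS](splitK i).
by case: (fintype.split i) => a; rewrite ffunE.
Qed.

Lemma sum_reps_row_mx (V : nmodType) k N1 N2 (f : 'rV[F]_(N1 + N2) -> V) :
  \sum_(v <- reps k (N1 + N2)) f v =
  \sum_(x <- reps k N1) \sum_(y <- reps k N2) f (row_mx x y).
Proof.
elim: k f => [|k IH] f; first by rewrite !sum_reps0 row_mx0.
rewrite sum_repsS.
under eq_bigr do rewrite IH rvec_row_mx.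
rewrite (sum_ffun_split (fun t1 t2 => \sum_(x <- reps k N1) \sum_(y <- reps k N2)
  f (row_mx (rvec t1) (rvec t2) + pi *: row_mx x y))).
rewrite sum_repsS; apply: eq_bigr => t1 _.
rewrite exchange_big /=; apply: eq_bigr => x _.
rewrite sum_repsS; apply: eq_bigr => t2 _; apply: eq_bigr => y _.
by rewrite scale_row_mx add_row_mx.
Qed.

Fixpoint reps1 k : seq F :=
  if k is k'.+1 then [seq r d + pi * a | d <- enum 'I_q, a <- reps1 k'] else [:: 0].

Lemma sum_reps1S (V : nmodType) k (f : F -> V) :
  \sum_(a <- reps1 k.+1) f a = \sum_(d < q) \sum_(a <- reps1 k) f (r d + pi * a).
Proof. by rewrite big_allpairs_dep big_enum. Qed.

Lemma sum_reps_prod k N (h : 'I_N -> F -> R) :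
  \sum_(v <- reps k N) \prod_i h i (v 0 i) = \prod_i \sum_(a <- reps1 k) h i a.
Proof.
elim: k h => [|k IH] h.
  by rewrite sum_reps0; apply: eq_bigr => i _; rewrite big_seq1 mxE.
rewrite sum_repsS.
under [RHS]eq_bigr do rewrite sum_reps1S.
rewrite bigA_distr_bigA /=; apply: eq_bigr => t _.
rewrite -(IH (fun i a => h i (r (t i) + pi * a))); apply: eq_bigr => v _.
by apply: eq_bigr => i _; rewrite !mxE.
Qed.

(** The size of the annihilator of [c] in O / pi^k, that is q^min(k, val c) for integral [c]. *)
Definition Gcount k (c : F) : R := \sum_(a <- reps1 k) (nrm (a * c) <= Q ^- k)%R%:R.

Lemma Gcount0 c : Gcount 0 c = 1.
Proof. by rewrite /Gcount big_seq1 mul0r (nrm0 lf) QinvX_ge0. Qed.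

Lemma reps1_reps k (f : F -> R) :
  \sum_(a <- reps1 k) f a = \sum_(v <- reps k 1) f (v 0 0).
Proof.
have := sum_reps_prod k (fun (_ : 'I_1) a => f a).
by rewrite big_ord1 => <-; apply: eq_bigr => v _; rewrite big_ord1.
Qed.

Lemma reps1_int k a : a \in reps1 k -> nrm a <= 1.
Proof.
elim: k a => [|k IH] a; first by rewrite inE => /eqP ->; rewrite (nrm0 lf) ler01.
case/allpairsP => -[d b] /= [_ /IH hb ->].
by rewrite (nrmD_le lf) // (nrmM_le1 lf) // nrm_pi ltW // Qinv_lt1.
Qed.

Lemma Gcount_mod k c c' : nrm c' <= Q ^- k -> Gcount k (c + c') = Gcount k c.
Proof.
move=> hc'; rewrite /Gcount big_seq [RHS]big_seq; apply: eq_bigr => a ha.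
rewrite mulrDr (nrm_addr_le lf) // (lf_nrmM lf) -[Q ^- k]mul1r.
by rewrite ler_pM ?(nrm_ge0 lf) // (reps1_int ha).
Qed.

(** The condition for [pi * c] modulo pi^(k+1) is the one for [c] modulo pi^k, which leaves the top
    digit of [a] free. *)
Lemma Gcount_pi k c : nrm c <= 1 -> Gcount k.+1 (pi * c) = Q * Gcount k c.
Proof.
move=> hc; rewrite /Gcount reps1_reps reps1_reps.
rewrite -[Q in RHS]expr1 -(sum_reps_coarsen (k := k)); last first.
  move=> v w /intvP hv /intvP hw; rewrite !mxE mulrDl (nrm_addr_le lf) //.
  rewrite -mulrA nrm_piX_mul_le; exact: (nrmM_le1 lf).
by apply: eq_bigr => v _; rewrite mulrCA nrm_pi_mul_le.
Qed.

Lemma Gcount_unit k c : nrm c = 1 -> Gcount k c = 1.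
Proof.
move=> hc; elim: k => [|k IH]; first exact: Gcount0.
rewrite /Gcount sum_reps1S.
under eq_bigr do under eq_bigr do rewrite (lf_nrmM lf) hc mulr1.
have hz : nrm 0 <= 1 by rewrite (nrm0 lf) ler01.
(* Since [c] is a unit, [a] itself lies in the ideal, so its first digit is that of zero; [r_lt1]
   makes the representative of this digit exactly [0]. *)
rewrite (bigD1 (red 0)) //= [X in _ + X]big1 => [|d hd]; last first.
  rewrite big_seq big1 // => a ha; apply/eqP; rewrite pnatr_eq0 eqb0.
  apply/negP => h; move/negP: hd; apply; rewrite -(red_lt1E _ hz) sub0r (nrmN lf).
  have hpa : nrm (pi * a) < 1.
    by rewrite nrm_pi_mul_lt1 (reps1_int ha).
  rewrite -(nrm_addr_lt lf _ hpa) (le_lt_trans h) //.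
  by rewrite -exprVn exprn_ilt1 ?invr_ge0 ?(ltW (lf_Q_gt0 lf)) ?Qinv_lt1.
have -> : r (red 0) = 0.
  by apply: r_lt1; rewrite -(nrmN lf) -sub0r redP.
rewrite addr0 -[RHS]IH; apply: eq_bigr => a _.
by rewrite add0r nrm_pi_mul_le (lf_nrmM lf) hc mulr1.
Qed.

(** * Haar measure of sets invariant modulo a power of the uniformizer *)

Section HaarMeasure.
Local Open Scope classical_set_scope.

Lemma vnorm_leE N (v : 'rV[F]_N) e : 0 <= e ->
  (vnorm nrm v <= e) = [forall j, nrm (v 0 j) <= e].
Proof.
move=> e0; apply/idP/forallP => [/bigmax_leP[_ h] j|h]; first exact: h.
by apply/bigmax_leP.
Qed.

Variables (N : nat) (mu : {measure set (Fvec nrm N) -> \bar R}).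
Hypothesis haar : normalized_haar mu.

(** Base point and scale are carried along for the induction in [mu_coset]: fixing one more digit
    moves [a] and raises [l]. *)
Definition coset_of_pred (a : 'rV[F]_N) l (P : pred 'rV[F]_N) : set (Fvec nrm N) :=
  [set v | exists w : 'rV[F]_N, [/\ intv w, P w & (v : 'rV[F]_N) = a + pi ^+ l *: w]].

Lemma intv_divpiX l (v : 'rV[F]_N) : (forall j, nrm (v 0 j) <= Q ^- l) ->
  exists2 w, intv w & v = pi ^+ l *: w.
Proof.
have pl0 : pi ^+ l != 0 by rewrite expf_neq0 // uniformizer_neq0.
move=> h; exists ((pi ^+ l)^-1 *: v); last by rewrite scalerA divff ?scale1r.
apply/intvP => j; rewrite mxE -(nrm_piX_mul_le _ l) mulrA divff ?mul1r //.
Qed.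

Lemma measurable_locally_invariant l (S : set (Fvec nrm N)) :
  (forall v w : 'rV[F]_N, S v -> intv w -> S (v + pi ^+ l *: w)) -> measurable S.
Proof.
move=> h; apply: sub_sigma_algebra => x Sx; exists (Q ^- l).
  by rewrite invr_gt0 exprn_gt0 // (lf_Q_gt0 lf).
move=> y /ltW; rewrite vnorm_leE ?QinvX_ge0 // => /forallP hy.
have [w hw e] := intv_divpiX hy.
have -> : y = (x : 'rV[F]_N) + pi ^+ l *: w by rewrite -e addrC subrK.
exact: h.
Qed.

Lemma measurable_coset a k l P : invmod k P -> measurable (coset_of_pred a l P).
Proof.
move=> hP; apply: (@measurable_locally_invariant (l + k)%N) => v w [w' [hw' Pw' ->]] hw.
exists (w' + pi ^+ k *: w); split.
- by rewrite intvD // intv_piX.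
- by rewrite hP.
- by rewrite scalerDr scalerA -exprD addrA.
Qed.

Lemma invmod_predT k : invmod k (predT : pred 'rV[F]_N).
Proof. by []. Qed.

Lemma intball_coset : intball nrm N = coset_of_pred 0 0 predT.
Proof.
rewrite /intball; apply/seteqP; split => v /=.
  rewrite vnorm_leE // => hv; exists v; split => //.
  by rewrite expr0 scale1r add0r.
move=> [w [hw _ ->]]; rewrite expr0 scale1r add0r vnorm_leE //.
Qed.

Definition ball_vol l : R := fine (mu (coset_of_pred 0 l predT)).

Lemma mu_coset_predT a l : mu (coset_of_pred a l predT) = (ball_vol l)%:E.
Proof.
have mT : measurable (coset_of_pred 0 l predT).
  by apply: (@measurable_coset _ 0); exact: invmod_predT.
have -> : coset_of_pred a l predT =
    [set ((a : Fvec nrm N) + t : Fvec nrm N) | t in coset_of_pred 0 l predT].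
  apply/seteqP; split => v /=.
    move=> [w [hw _ ->]]; exists (pi ^+ l *: w) => //; exists w; split => //.
    by rewrite add0r.
  by move=> [_ [w [hw _ ->]] <-]; exists w; split => //; rewrite add0r.
have -> : [set ((a : Fvec nrm N) + t : Fvec nrm N) | t in coset_of_pred 0 l predT] =
    [set (t + (a : Fvec nrm N) : Fvec nrm N) | t in coset_of_pred 0 l predT].
  by congr image; apply/funext => t; rewrite addrC.
rewrite (haar.1 _ _ mT) /ball_vol fineK // ge0_fin_numE //.
apply: (@le_lt_trans _ _ 1%E); last exact: ltry.
rewrite -haar.2; apply: le_measure; rewrite ?inE //.
  by rewrite intball_coset; apply: (@measurable_coset _ 0); exact: invmod_predT.
rewrite intball_coset => v [w [hw _ ->]]; exists (pi ^+ l *: w); split => //.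
  exact: intv_piX.
by rewrite expr0 scale1r.
Qed.

Lemma coset_step a l P : coset_of_pred a l P =
  \bigcup_(t in [set: {ffun 'I_N -> 'I_q}])
    coset_of_pred (a + pi ^+ l *: rvec t) l.+1 (fun v => P (rvec t + pi *: v)).
Proof.
have E t (w : 'rV[F]_N) : a + pi ^+ l *: rvec t + pi ^+ l.+1 *: w =
    a + pi ^+ l *: (rvec t + pi *: w).
  by rewrite scalerDr scalerA -exprSr addrA.
apply/seteqP; split => v.
  move=> [w [hw Pw ->]]; have [w' hw' e] := redvP hw.
  by exists (redv w) => //; exists w'; split => //; rewrite -?e ?E -?e.
move=> [t _ [w [hw Pw ->]]]; exists (rvec t + pi *: w); split => //.
by rewrite intvD ?intv_rvec ?intv_pi.
Qed.

Lemma mu_coset k l a P : invmod k P ->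
  mu (coset_of_pred a l P) = (ball_vol (l + k) * \sum_(v <- reps k N) (P v)%:R)%:E.
Proof.
elim: k l a P => [|k IH] l a P hP.
  have hP0 v : intv v -> P v = P 0.
    by move=> hv; rewrite -(hP 0 v (intv0 N) hv) expr0 scale1r add0r.
  rewrite sum_reps0 addn0; case: (boolP (P 0)) => P0.
    rewrite mulr1 -(mu_coset_predT a l); congr (mu _); apply/seteqP.
    split => v [w [hw Pw ->]]; exists w; split => //.
    by rewrite hP0.
  rewrite mulr0 -[RHS](measure0 mu); congr (mu _); apply/seteqP; split => // v.
  by move=> [w [hw + _]]; rewrite hP0 // (negbTE P0).
have hPt t : invmod k (fun v => P (rvec t + pi *: v)).
  by apply: invmodS => //; exact: intv_rvec.
rewrite coset_step measure_fin_bigcup //; last 2 first.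
- move=> t1 t2 _ _ [v [[w1 [hw1 _ e1]] [w2 [hw2 _ e2]]]].
  have pl0 : pi ^+ l != 0 by rewrite expf_neq0 // uniformizer_neq0.
  have E : rvec t1 + pi *: w1 = rvec t2 + pi *: w2.
    apply: (scalerI pl0); move: e1; rewrite e2 -!addrA => /addrI.
    by rewrite !scalerDr !scalerA -!exprSr.
  have h1 : intv (rvec t1 + pi *: w1) by rewrite intvD ?intv_rvec ?intv_pi.
  by rewrite (redv_uniq h1 hw1 erefl) (redv_uniq h1 hw2 E).
- by move=> t _; exact: measurable_coset (hPt t).
rewrite (fsbigE (enum {ffun 'I_N -> 'I_q})) ?enum_uniq //; last first.
  by move=> t _; rewrite mem_enum.
rewrite big_mkcond /= big_enum.
rewrite (eq_bigr (fun t => (ball_vol (l + k.+1) *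
   \sum_(v <- reps k N) (P (rvec t + pi *: v))%:R)%:E)) => [|t _]; last first.
  by rewrite in_setT (IH _ _ _ (hPt t)) addSnnS.
  by rewrite sumEFin sum_repsS mulr_sumr.
exact: finite_finset.
Qed.

(** The unit ball has volume one and is cut into q^(N l) translates of the small ball; this fixes
    the volume that [mu_coset] leaves undetermined. *)
Lemma ball_volE l : ball_vol l = Q ^- (N * l).
Proof.
have := mu_coset 0 0 (@invmod_predT l).
rewrite -intball_coset haar.2 add0n /= sum_reps_const mulr1 => -[] e.
have h : Q ^+ (N * l) != 0 by rewrite expf_neq0 // (lf_Q_neq0 lf).
by apply: (mulIf h); rewrite mulVf.
Qed.

Lemma haar_count k (P : pred 'rV[F]_N) : invmod k P ->
  mu [set v | intv (v : 'rV[F]_N) /\ P v] =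
  ((\sum_(v <- reps k N) (P v)%:R) / Q ^+ (N * k))%:E.
Proof.
move=> hP; rewrite mulrC -ball_volE -[k in ball_vol k]add0n -(mu_coset 0 0 hP).
congr (mu _); apply/seteqP; split => v /=.
  by move=> [hv Pv]; exists v; split => //; rewrite expr0 scale1r add0r.
by move=> [w [hw Pw ->]]; rewrite expr0 scale1r add0r.
Qed.
End HaarMeasure.

(** * Duality *)

Lemma nrm_piX_mul_lt x k : (nrm (pi ^+ k * x) <= Q ^- k.+1) = (nrm x < 1).
Proof.
rewrite -(nrm_discrete lf) (lf_nrmM lf) nrm_piX gtr_pMr // invr_gt0 exprn_gt0 //.
exact: lf_Q_gt0 lf.
Qed.

Definition dotv N (v w : 'rV[F]_N) : F := \sum_j v 0 j * w 0 j.

Lemma dotvDl N (v v' w : 'rV[F]_N) : dotv (v + v') w = dotv v w + dotv v' w.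
Proof. by rewrite -big_split; apply: eq_bigr => j _; rewrite mxE mulrDl. Qed.

Lemma dotvZl N a (v w : 'rV[F]_N) : dotv (a *: v) w = a * dotv v w.
Proof. by rewrite mulr_sumr; apply: eq_bigr => j _; rewrite mxE mulrA. Qed.

Lemma nrm_dotv N (v w : 'rV[F]_N) : intv v -> intv w -> nrm (dotv v w) <= 1.
Proof.
move=> /intvP hv /intvP hw; apply: (nrm_sum_le lf); first exact: ler01.
by move=> j _; exact: (nrmM_le1 lf).
Qed.

(* A real-valued stand-in for an additive character of O / pi^k: its average
   over a nonzero ideal of O / pi^k vanishes. *)
Definition charker k (b : F) : R :=
  Q * (nrm b <= Q ^- k)%R%:R - (nrm (pi * b) <= Q ^- k)%R%:R.

(** If [w] is nonzero modulo pi^k, some integral vector pairs with it to pi^(k-1). Translating by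
    multiples of that vector shows that the q classes making up the larger ball are hit equally
    often, so the two terms of [charker] cancel. *)
Lemma sum_charker k N (w : 'rV[F]_N) : intv w ->
  \sum_(v <- reps k N) charker k (dotv v w) =
  (Q - 1) * Q ^+ (N * k) * [forall j, nrm (w 0 j) <= Q ^- k]%:R.
Proof.
move=> hw; have [/forallP hk|/forallPn[j hj]] := boolP [forall j, nrm (w 0 j) <= Q ^- k].
  rewrite mulr1 mulrC -sum_reps_const big_seq [RHS]big_seq.
  apply: eq_bigr => v /reps_int/intvP hv.
  have h : nrm (dotv v w) <= Q ^- k.
    apply: (nrm_sum_le lf) => [|i _]; first exact: QinvX_ge0.
    by rewrite (lf_nrmM lf) -[Q ^- k]mul1r ler_pM ?(nrm_ge0 lf) ?hv.
  rewrite /charker h mulr1 (lf_nrmM lf) nrm_pi.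
  suff -> : Q^-1 * nrm (dotv v w) <= Q ^- k by [].
  by rewrite -[Q ^- k]mul1r ler_pM ?(nrm_ge0 lf) ?invr_ge0 ?(ltW (lf_Q_gt0 lf)) ?(ltW Qinv_lt1).
rewrite mulr0; case: k hj => [|k] hj.
  by move/intvP: hw => /(_ j); rewrite expr0 invr1 in hj; rewrite (negbTE hj).
have hjk : Q ^- k <= nrm (w 0 j) by rewrite leNgt (nrm_discrete lf).
have hj0 : w 0 j != 0.
  by apply: contraNneq hj => ->; rewrite (nrm0 lf) QinvX_ge0.
(* The modulus is now pi^(k+1), and [hjk] says that [w 0 j] divides pi^k, so [v0] is integral. *)
pose v0 : 'rV[F]_N := \row_i (if i == j then pi ^+ k / w 0 j else 0).
have hv0 : intv v0.
  apply/intvP => i; rewrite mxE; case: eqP => _; last by rewrite (nrm0 lf) ler01.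
  by rewrite (lf_nrmM lf) (nrmV lf) nrm_piX ler_pdivrMr ?mul1r ?(nrm_gt0 lf).
have dv0 : dotv v0 w = pi ^+ k.
  rewrite /dotv (bigD1 j) //= mxE eqxx divfK // big1 ?addr0 // => i /negbTE ij.
  by rewrite mxE ij mul0r.
have split_ball b : (nrm (pi * b) <= Q ^- k.+1)%R%:R =
    \sum_(i < q) (nrm (b - r i * pi ^+ k) <= Q ^- k.+1)%R%:R :> R.
  rewrite nrm_pi_mul_le; have [hb|hb] := boolP (nrm b <= Q ^- k).
    have pk0 : pi ^+ k != 0 by rewrite expf_neq0 // uniformizer_neq0.
    have [b' eb] : exists b', b = pi ^+ k * b' by exists (b / pi ^+ k); rewrite mulrC divfK.
    have hb' : nrm b' <= 1 by rewrite -(nrm_piX_mul_le _ k) -eb.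
    rewrite (bigD1 (red b')) //= big1 => [|i /negbTE hi].
      by rewrite eb (mulrC (r _)) -mulrBr nrm_piX_mul_lt redP ?addr0.
    by rewrite eb (mulrC (r _)) -mulrBr nrm_piX_mul_lt red_lt1E // hi.
  rewrite big1 // => i _; apply/eqP; rewrite pnatr_eq0 eqb0.
  apply: contra hb => h; rewrite -(subrK (r i * pi ^+ k) b) (nrmD_le lf) //.
    apply: le_trans h _; rewrite exprS invfM ler_piMl ?QinvX_ge0 //.
    exact/ltW/Qinv_lt1.
  by rewrite (lf_nrmM lf) nrm_piX ler_piMl ?QinvX_ge0.
have inv_ball c : invmod k.+1 (fun v => (nrm (dotv v w + c) <= Q ^- k.+1)%R%:R : R).
  move=> v v' hv hv'; rewrite dotvDl dotvZl addrAC (nrm_addr_le lf (dotv v w + c)) //.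
  by rewrite nrm_piX_mul_le nrm_dotv.
rewrite /charker sumrB; apply/eqP; rewrite subr_eq0; apply/eqP.
under [RHS]eq_bigr do rewrite split_ball.
rewrite exchange_big [RHS](eq_bigr (fun=> \sum_(v <- reps k.+1 N)
   (nrm (dotv v w) <= Q ^- k.+1)%R%:R)).
  by rewrite sumr_const card_ord -sumrMnl; apply: eq_bigr => v _; rewrite mulr_natl.
move=> i _; rewrite -(sum_reps_translate (w := r i *: v0)
  (f := fun v => (nrm (dotv v w - r i * pi ^+ k) <= Q ^- k.+1)%R%:R)).
- apply: eq_bigr => v _; rewrite dotvDl dotvZl dv0 -addrA subrr addr0 //.
- exact: intvZ.
- exact: inv_ball.
Qed.

(** * Duality for the moment map, and linear algebra over O with unit minors *)

Section GoodReduction.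
Variables (n m : nat) (AF : 'M[F]_(n, m)).
Hypothesis AF_int : forall i j, nrm (AF i j) <= 1.
Hypothesis AF_minor : forall k (f : 'I_k -> 'I_n) (g : 'I_k -> 'I_m),
  \det (\matrix_(i, j) AF (f i) (g j)) != 0 ->
  nrm (\det (\matrix_(i, j) AF (f i) (g j))) = 1.

Definition pair_a (v : 'rV[F]_m) : 'rV[F]_n := v *m AF^T.

Lemma pair_aD v w : pair_a (v + w) = pair_a v + pair_a w.
Proof. exact: mulmxDl. Qed.

Lemma pair_aZ c v : pair_a (c *: v) = c *: pair_a v.
Proof. by rewrite /pair_a -scalemxAl. Qed.

Lemma pair_a_lin v c w i : pair_a (v + c *: w) 0 i = pair_a v 0 i + c * pair_a w 0 i.
Proof. by rewrite pair_aD pair_aZ mxE [X in _ + X]mxE. Qed.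

Lemma pair_aE v i : pair_a v 0 i = \sum_j v 0 j * AF i j.
Proof. by rewrite mxE; apply: eq_bigr => j _; rewrite mxE. Qed.

Lemma pair_a_int v : intv v -> intv (pair_a v).
Proof.
move=> /intvP hv; apply/intvP => i; rewrite pair_aE.
apply: (nrm_sum_le lf) => [|j _]; first exact: ler01.
exact: (nrmM_le1 lf).
Qed.

(** For fixed [x] the moment map is linear in [y]; the right-hand side is its transpose. *)
Lemma dotv_moment (x y : 'rV[F]_n) v :
  dotv v (moment AF (row_mx x y)) = dotv y (\row_i (x 0 i * pair_a v 0 i)).
Proof.
rewrite /dotv; under eq_bigr do rewrite mxE mulr_sumr.
rewrite exchange_big /=; apply: eq_bigr => i _.
rewrite mxE pair_aE !mulr_sumr; apply: eq_bigr => j _.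
by rewrite row_mxEl row_mxEr; ring.
Qed.

Lemma moment_int (z : 'rV[F]_(n + n)) : intv z -> intv (moment AF z).
Proof.
move=> /intvP hz; apply/intvP => j; rewrite mxE.
apply: (nrm_sum_le lf) => [|i _]; first exact: ler01.
by rewrite !(nrmM_le1 lf).
Qed.

Definition moment_ball k (z : 'rV[F]_(n + n)) :=
  [forall j, nrm (moment AF z 0 j) <= Q ^- k].

(** Counts pairs (x, v) modulo pi^k with x_i <v, a_i> = 0 for all i in [J], where [x] has
    coordinates in [J] only. Smaller [J] are needed because the recursion passes to residual
    flats. *)
Definition Ucount k (J : {set 'I_n}) : R :=
  \sum_(v <- reps k m) \prod_(i in J) Gcount k (pair_a v 0 i).

Lemma count_moment_ball k :
  Q ^+ (m * k) * \sum_(z <- reps k (n + n)) (moment_ball k z)%:R =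
  Q ^+ (n * k) * Ucount k [set: 'I_n].
Proof.
have Q1 : Q - 1 != 0 by rewrite subr_eq0 gt_eqF // (lf_Q_gt1 lf).
apply: (mulfI Q1); rewrite sum_reps_row_mx.
(* Summing over [v] first detects mu(x, y) = 0; summing over [y] first detects x_i <v, a_i> = 0 for
   all i. Both orders produce the factor [Q - 1] cancelled above. *)
transitivity (\sum_(x <- reps k n) \sum_(y <- reps k n) \sum_(v <- reps k m)
    charker k (dotv v (moment AF (row_mx x y)))).
  rewrite !mulr_sumr big_seq [RHS]big_seq; apply: eq_bigr => x hx.
  rewrite !mulr_sumr big_seq [RHS]big_seq; apply: eq_bigr => y hy.
  rewrite sum_charker ?mulrA //; apply: moment_int.
  apply/intvP => j; rewrite mxE; case: splitP => i _.
    exact/intvP/(reps_int hx).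
  exact/intvP/(reps_int hy).
under eq_bigr do rewrite exchange_big /=.
rewrite exchange_big /= /Ucount !mulr_sumr big_seq [RHS]big_seq.
apply: eq_bigr => v hv.
have -> : \prod_(i in [set: 'I_n]) Gcount k (pair_a v 0 i) =
    \sum_(x <- reps k n) \prod_i (nrm (x 0 i * pair_a v 0 i) <= Q ^- k)%R%:R.
  rewrite (sum_reps_prod k (fun i a => (nrm (a * pair_a v 0 i) <= Q ^- k)%R%:R)).
  by apply: eq_bigl => i; rewrite inE.
rewrite !mulr_sumr big_seq [RHS]big_seq; apply: eq_bigr => x hx.
under eq_bigr do rewrite dotv_moment.
rewrite sum_charker; last first.
  apply/intvP => i; rewrite mxE (nrmM_le1 lf) //; first exact/intvP/(reps_int hx).
  exact/intvP/pair_a_int/(reps_int hv).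
rewrite mulrA; congr (_ * _); rewrite -natr_prod; congr (_ %:R).
have [/forallP h|/forallPn[i hi]] :=
  boolP [forall j, nrm ((\row_i (x 0 i * pair_a v 0 i)) 0 j) <= Q ^- k].
  by rewrite big1 // => i _; have := h i; rewrite mxE => ->.
by rewrite (bigD1 i) //=; move: hi; rewrite mxE => /negbTE ->; rewrite mul0n.
Qed.

Lemma Ucount0 J : Ucount 0 J = 1.
Proof. by rewrite /Ucount sum_reps0 big1 // => i _; rewrite Gcount0. Qed.

Lemma nrm_det_int k (M : 'M[F]_k) : (forall i j, nrm (M i j) <= 1) -> nrm (\det M) <= 1.
Proof.
move=> hM; apply: (nrm_sum_le lf) => [|s _]; first exact: ler01.
apply: (nrmM_le1 lf).
  by rewrite (nrmX lf) (nrmN lf) (nrm1 lf) expr1n.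
by elim/big_rec: _ => [|i x _ hx]; rewrite ?(nrm1 lf) // (nrmM_le1 lf).
Qed.

(** [f] picks a basis of the rows and [g] independent columns of it, so the minor is nonzero and
    hence a unit. The other rows in [H] are combinations over [F] of the basis, which gives the last
    clause. *)
Lemma unit_minor (H : {set 'I_n}) : exists (f : 'I_(rk AF H) -> 'I_n) (g : 'I_(rk AF H) -> 'I_m),
  [/\ forall l, f l \in H,
      nrm (\det (\matrix_(i, j) AF (f i) (g j))) = 1 &
      forall v, (forall l, pair_a v 0 (f l) = 0) -> forall i, i \in H -> pair_a v 0 i = 0].
Proof.
pose f := maxrankfun (rowsJ AF H); pose B := rowsub f (rowsJ AF H).
have fB : row_free B := maxrowsub_free _.
have fBT : row_full B^T by rewrite /row_full mxrank_tr.
pose g := fullrankfun fBT.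
have fH l : f l \in H.
  apply: contraT => hl.
  have : delta_mx 0 l *m B = 0 *m B :> 'rV_m.
    by rewrite -rowE mul0mx; apply/rowP => j; rewrite !mxE (negbTE hl).
  by move/(row_free_inj fB)/matrixP/(_ 0 l)/eqP; rewrite !mxE !eqxx oner_eq0.
exists f, g; split => //.
  apply: AF_minor; rewrite -unitfE -[_ \is a _]/(_ \in unitmx) -unitmx_tr.
  suff -> : (\matrix_(i, j) AF (f i) (g j))^T = rowsub g B^T by exact: fullrowsub_unit.
  by apply/matrixP => i j; rewrite !mxE fH.
move=> v hv i iH.
have : (row i (rowsJ AF H) <= B)%MS.
  by rewrite (submx_trans (row_sub _ _)) // eq_maxrowsub.
case/submxP => D /rowP hD.
rewrite pair_aE.
under eq_bigr => j _.
  have := hD j; rewrite !mxE iH => ->.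
  over.
under eq_bigr do rewrite mulr_sumr.
rewrite exchange_big big1 //= => l _.
transitivity (D 0 l * pair_a v 0 (f l)); last by rewrite hv mulr0.
by rewrite pair_aE mulr_sumr; apply: eq_bigr => j _; rewrite !mxE fH; ring.
Qed.

(** Cramer's rule: the adjugate is integral and the determinant is a unit. *)
Lemma solve_minor k (f : 'I_k -> 'I_n) (g : 'I_k -> 'I_m) (b : 'rV[F]_k) :
  nrm (\det (\matrix_(i, j) AF (f i) (g j))) = 1 -> intv b ->
  exists2 v, intv v & forall l, pair_a v 0 (f l) = b 0 l.
Proof.
set B := \matrix_(i, j) _ => dB /intvP hb.
have uB : B^T \in unitmx.
  rewrite unitmx_tr unitmxE unitfE; apply: contra_eq_neq dB => ->.
  by rewrite (nrm0 lf) eq_sym oner_eq0.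
pose c := b *m invmx B^T.
have hc : c *m B^T = b by rewrite mulmxKV.
have cint l : nrm (c 0 l) <= 1.
  rewrite mxE; apply: (nrm_sum_le lf) => [|i _]; first exact: ler01.
  apply: (nrmM_le1 lf) => //; rewrite /invmx uB mxE (lf_nrmM lf) (nrmV lf) det_tr dB.
  rewrite invr1 mul1r mxE /cofactor (lf_nrmM lf) (nrmX lf) (nrmN lf) (nrm1 lf) expr1n mul1r.
  by apply: nrm_det_int => a a'; rewrite !mxE.
(* Summing over the fibre of [g] spares a proof that [g] is injective. *)
exists (\row_j \sum_(l | g l == j) c 0 l).
  apply/intvP => j; rewrite mxE; apply: (nrm_sum_le lf) => //; exact: ler01.
move=> l; rewrite -hc pair_aE mxE.
under eq_bigr do rewrite mxE mulr_suml.
rewrite (exchange_big_dep predT) //=; apply: eq_bigr => l' _.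
by rewrite (big_pred1 (g l')) => [|j]; rewrite ?mxE // eq_sym.
Qed.

(* Hensel-type lifting: the minors being units, a solution mod pi of the
   equations indexed by [H] lifts to an exact solution. *)
Lemma lift_zeros (H : {set 'I_n}) v : intv v ->
  (forall i, i \in H -> nrm (pair_a v 0 i) < 1) ->
  exists v1 w, [/\ intv v1, intv w, v = v1 + pi *: w &
    forall i, i \in H -> pair_a v1 0 i = 0].
Proof.
move=> hv hH; have [f [g [fH dfg hfg]]] := unit_minor H.
have [|w hw ew] := @intv_divpi _ (\row_l pair_a v 0 (f l)).
  by move=> l; rewrite mxE hH.
have [w' hw' ew'] := solve_minor dfg hw.
exists (v - pi *: w'), w'; split => //; last 2 first.
- by rewrite subrK.
- apply: hfg => l; rewrite -scaleNr pair_a_lin ew'.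
  by move/rowP: ew => /(_ l); rewrite mxE [RHS]mxE => ->; rewrite mulNr subrr.
by rewrite -scaleNr intvD // intvZ ?(nrmN lf) ?nrm_pi ?ltW ?Qinv_lt1.
Qed.

(** * Counting by residual flats *)

Definition residual_zeros (J : {set 'I_n}) (t : {ffun 'I_m -> 'I_q}) : {set 'I_n} :=
  [set i in J | nrm (pair_a (rvec t) 0 i) < 1].
Local Notation Z := residual_zeros.

Lemma residual_zeros_sub J t : Z J t \subset J.
Proof. by apply/fintype.subsetP => i; rewrite inE => /andP[]. Qed.

Lemma nrm_pair_a_lt1_lift v w i : intv w ->
  (nrm (pair_a (v + pi *: w) 0 i) < 1) = (nrm (pair_a v 0 i) < 1).
Proof.
move=> hw; rewrite pair_a_lin (nrm_addr_lt lf) //.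
by rewrite nrm_pi_mul_lt1; exact/intvP/pair_a_int.
Qed.

(** Lift the residual zeros to a vector [v1] with exact zeros: any form that vanishes with them over
    [F] vanishes at [v1], hence at [rvec t] modulo [pi]. *)
Lemma residual_zeros_flat J t : is_flat AF J -> is_flat AF (Z J t).
Proof.
move=> fJ; apply: flatI => i hi.
have [|v1 [w [hv1 hw e hz]]] := @lift_zeros (Z J t) (rvec t) (intv_rvec t).
  by move=> j; rewrite inE => /andP[].
have iJ : i \in J.
  apply: (is_flatP fJ) => v hv; apply: hi => j; rewrite inE => /andP[/hv ->//].
by rewrite inE iJ e nrm_pair_a_lt1_lift // [pair_a _ _ _]hi ?(nrm0 lf) ?ltr01.
Qed.

(** Outside [Z J t] the pairing is a unit and contributes 1. Inside, writing [rvec t] as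
    [v1 + pi *: w] with exact zeros at [v1] lets [pi] factor out, and the leftover shift by [w]
    disappears by translation invariance. *)
Lemma Ucount_residual k (J : {set 'I_n}) t :
  \sum_(v <- reps k m) \prod_(i in J) Gcount k.+1 (pair_a (rvec t + pi *: v) 0 i) =
  Q ^+ #|Z J t| * Ucount k (Z J t).
Proof.
have [|v1 [w [hv1 hw e hz]]] := @lift_zeros (Z J t) (rvec t) (intv_rvec t).
  by move=> j; rewrite inE => /andP[].
pose f (v : 'rV[F]_m) := \prod_(i in Z J t) Gcount k (pair_a v 0 i).
transitivity (\sum_(v <- reps k m) Q ^+ #|Z J t| * f (v + w)).
  rewrite big_seq [RHS]big_seq; apply: eq_bigr => v /reps_int hv.
  rewrite (big_setID (Z J t)) /= (finset.setIidPr (residual_zeros_sub J t)).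
  rewrite [X in _ * X]big1 ?mulr1 => [|i].
    rewrite -prodr_const /f -big_split; apply: eq_bigr => i iZ /=.
    rewrite -Gcount_pi; last exact/intvP/pair_a_int/intvD.
    congr Gcount; rewrite e -addrA -scalerDr (addrC w) (pair_aD v1) pair_aZ.
    by rewrite mxE hz // add0r mxE.
  rewrite !inE => /andP[+ iJ]; rewrite iJ /= -leNgt => h.
  apply: Gcount_unit; apply/eqP; rewrite eq_le; apply/andP; split.
    by apply/intvP/pair_a_int/intvD; [exact: intv_rvec|exact: intv_pi].
  by rewrite leNgt nrm_pair_a_lt1_lift // -leNgt.
rewrite -mulr_sumr sum_reps_translate // => v v' hv hv'.
apply: eq_bigr => i _; rewrite pair_a_lin Gcount_mod //.
by rewrite nrm_piX_mul_le; exact/intvP/pair_a_int.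
Qed.

Lemma UcountS_residual k (J : {set 'I_n}) :
  Ucount k.+1 J = \sum_t Q ^+ #|Z J t| * Ucount k (Z J t).
Proof. by rewrite /Ucount sum_repsS; apply: eq_bigr => t _; exact: Ucount_residual. Qed.

(* The residual map to [F_q^rk(H)] given by a unit minor is onto, and its fibres
   are translates of the residual zero set. *)
Lemma card_residual_zeros (H : {set 'I_n}) :
  #|[set t : {ffun 'I_m -> 'I_q} | [forall i in H, nrm (pair_a (rvec t) 0 i) < 1]]|
  = (q ^ (m - rk AF H))%N.
Proof.
have [f [g [fH dfg hfg]]] := unit_minor H.
set N := #|_|.
pose phi (t : {ffun 'I_m -> 'I_q}) : {ffun 'I_(rk AF H) -> 'I_q} :=
  [ffun l => red (pair_a (rvec t) 0 (f l))].
have Hf t : [forall i in H, nrm (pair_a (rvec t) 0 i) < 1] =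
            [forall l, nrm (pair_a (rvec t) 0 (f l)) < 1].
  apply/forall_inP/forallP => [h l|h i iH]; first exact: h.
  (* Exact zeros on the basis rows propagate to all of [H], whereas residual ones need the lift
     first. *)
  have [|v1 [w [hv1 hw e hz]]] := @lift_zeros [set f l | l in 'I_(rk AF H)] (rvec t) (intv_rvec t).
    by move=> _ /imsetP[l _ ->].
  rewrite e nrm_pair_a_lt1_lift // (hfg v1) ?(nrm0 lf) ?ltr01 // => l.
  by apply: hz; rewrite imset_f.
have fib (b : {ffun 'I_(rk AF H) -> 'I_q}) : #|[set t | phi t == b]| = N.
  have [v hv ev] := solve_minor dfg (intv_rvec b).
  rewrite /N -!sum1_card [LHS](reindex_inj (redv_shift_inj hv)); apply: eq_bigl => t.
  rewrite !inE Hf.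
  have htv : intv (rvec t + v) by rewrite intvD ?intv_rvec.
  have [w hw e] := redvP htv; set t' := redv _ in e *.
  have key l : (phi t' l == b l) = (nrm (pair_a (rvec t) 0 (f l)) < 1).
    rewrite ffunE eq_sym -red_lt1E; last exact/intvP/pair_a_int/intv_rvec.
    have -> : pair_a (rvec t') 0 (f l) - r (b l) =
        pair_a (rvec t) 0 (f l) + - (pi * pair_a w 0 (f l)).
      have -> : rvec t' = rvec t + v - pi *: w by rewrite e addrK.
      rewrite -[v]scale1r -scaleNr !pair_a_lin ev.
      by rewrite [rvec b 0 l]mxE; ring.
    rewrite (nrm_addr_lt lf) // (nrmN lf) nrm_pi_mul_lt1.
    exact/intvP/pair_a_int.
  apply/eqP/forallP => [h l|h]; first by rewrite -key h.
  by apply/ffunP => l; apply/eqP; rewrite key.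
have : (q ^ rk AF H * N = q ^ rk AF H * q ^ (m - rk AF H))%N.
  rewrite -expnD subnKC ?rk_le //.
  transitivity #|{ffun 'I_m -> 'I_q}|; last by rewrite card_ffun !card_ord.
  rewrite -[RHS]sum1_card (partition_big phi predT) //=.
  rewrite (eq_bigr (fun=> N)) => [|b _]; last first.
    by rewrite -(fib b) -sum1_card; apply: eq_bigl => t; rewrite inE.
  by rewrite sum_nat_const card_ffun !card_ord.
by move/eqP; rewrite eqn_pmul2l ?expn_gt0 ?(ltnW (lf_q_gt1 lf)) // => /eqP.
Qed.

Lemma card_residual_fibre G J : is_flat AF G -> is_flat AF J -> G \subset J ->
  #|[set t | Z J t == G]|%:R = Q ^+ (m - rk AF J) * charpoly_eval AF G J Q.
Proof.
move=> fG fJ GJ.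
(* By [mobius_sum] the inner sum is the indicator of [Z J t == G]. *)
transitivity (\sum_t \sum_(H : {set 'I_n} | [&& is_flat AF H, G \subset H & H \subset Z J t])
    (mobius AF G H)%:~R : R).
  rewrite -sum1_card natr_sum big_mkcond; apply: eq_bigr => t _; rewrite inE.
  rewrite -rmorph_sum /=; have [GZ|GZ] := boolP (G \subset Z J t).
    rewrite mobius_sum ?residual_zeros_flat // eq_sym.
    by case: eqP => _; rewrite ?mulr1z ?mulr0z.
  rewrite big_pred0 => [|H].
    by rewrite mulr0z; case: eqP => // e; rewrite e fintype.subxx in GZ.
  apply/negP => /and3P[_ GH HZ].
  by rewrite (fintype.subset_trans GH HZ) in GZ.
rewrite (exchange_big_dep (fun H => [&& is_flat AF H, G \subset H & H \subset J])) /=; last first.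
  by move=> t H _ /and3P[-> -> /fintype.subset_trans -> //]; exact: residual_zeros_sub.
rewrite /charpoly_eval mulr_sumr; apply: eq_bigr => H /and3P[fH GH HJ].
rewrite (eq_bigl [in [set t | [forall i in H, nrm (pair_a (rvec t) 0 i) < 1]]]) => [|t].
  rewrite sumr_const card_residual_zeros -[LHS]mulr_natr natrX mulrCA -exprD.
  congr (_ * _ ^+ _); rewrite !dimHE.
  by have := rk_mono AF HJ; have := rk_le AF J; lia.
rewrite inE fH GH /=; apply/fintype.subsetP/forall_inP => h i /[dup] iH /h; rewrite inE.
  by case/andP.
by move=> ->; rewrite (fintype.subsetP HJ).
Qed.

Lemma UcountS k J : is_flat AF J ->
  Ucount k.+1 J = \sum_(G : {set 'I_n} | is_flat AF G && (G \subset J))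
    Q ^+ (m - rk AF J) * charpoly_eval AF G J Q * Q ^+ #|G| * Ucount k G.
Proof.
move=> fJ; rewrite UcountS_residual.
rewrite (partition_big (Z J) (fun G => is_flat AF G && (G \subset J))) /=; last first.
  by move=> t _; rewrite residual_zeros_flat // residual_zeros_sub.
apply: eq_bigr => G /andP[fG GJ]; rewrite -card_residual_fibre // -mulrA mulr_natl.
rewrite (eq_bigr (fun=> Q ^+ #|G| * Ucount k G)) => [|t /eqP-> //].
by rewrite -sumr_const; apply: eq_bigl => t; rewrite inE.
Qed.

(** The factor [Q ^+ rk AF J] absorbs the q^(m - rk J) of the recursion. Dividing by q^(n k) even
    for smaller [J] is what leaves n - |G| in the exponent, completing [delta]. *)
Definition Wcount k (J : {set 'I_n}) : R :=
  Q ^+ rk AF J * Ucount k J / Q ^+ ((n + m) * k).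

Lemma Wcount0 J : Wcount 0 J = Q ^+ rk AF J.
Proof. by rewrite /Wcount Ucount0 muln0 expr0 divr1 mulr1. Qed.

Lemma WcountS k J : is_flat AF J ->
  Wcount k.+1 J = \sum_(G : {set 'I_n} | is_flat AF G && (G \subset J))
    charpoly_eval AF G J Q / Q ^+ delta AF G * Wcount k G.
Proof.
move=> fJ; rewrite /Wcount UcountS // mulr_sumr mulr_suml; apply: eq_bigr => G _.
have [e1 e2] : (n + m = rk AF J + (m - rk AF J) + (n - #|G|) + #|G|)%N /\
    (delta AF G = n - #|G| + rk AF G)%N.
  split=> //; have := max_card G; rewrite card_ord; have := rk_le AF J; lia.
have hX k' : Q ^+ k' != 0 by rewrite expf_neq0 // (lf_Q_neq0 lf).
have e3 : Q ^+ (n + m) = Q ^+ rk AF J * Q ^+ (m - rk AF J) * Q ^+ (n - #|G|) * Q ^+ #|G|.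
  by rewrite -!exprD -e1.
rewrite e2 mulnS !(exprD _ (n + m)) !(exprD _ (n - #|G|)) e3.
move: (hX (rk AF J)) (hX (m - rk AF J)%N) (hX (n - #|G|)%N) (hX #|G|)
  (hX ((n + m) * k)%N) (hX (rk AF G)).
move: (Q ^+ _) (Q ^+ _) (Q ^+ _) (Q ^+ _) (Q ^+ _) (Q ^+ _) (Ucount _ _) (charpoly_eval _ _ _ _).
by move=> *; field; do ?[apply/andP; split].
Qed.

Lemma Wcount_vol k : rk AF [set: 'I_n] = m ->
  (\sum_(z <- reps k (n + n)) (moment_ball k z)%:R) / Q ^+ ((n + n) * k) =
  Wcount k [set: 'I_n] / Q ^+ m.
Proof.
move=> rm; have := count_moment_ball k; rewrite /Wcount rm => e.
have hX k' : Q ^+ k' != 0 by rewrite expf_neq0 // (lf_Q_neq0 lf).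
apply: (mulfI (hX (m * k)%N)); rewrite mulrA e !mulnDl !exprD.
by field; rewrite ?hX.
Qed.

(** Up to a positive power of q this value is a cardinality. *)
Lemma charpoly_ge0 G J : is_flat AF G -> is_flat AF J -> G \subset J ->
  0 <= charpoly_eval AF G J Q.
Proof.
move=> fG fJ GJ; have := ler0n R #|[set t | Z J t == G]|.
by rewrite card_residual_fibre // pmulr_rge0 // exprn_gt0 // (lf_Q_gt0 lf).
Qed.

Lemma sum_charpoly J : is_flat AF J ->
  \sum_(G : {set 'I_n} | is_flat AF G && (G \subset J)) charpoly_eval AF G J Q =
  Q ^+ rk AF J.
Proof.
move=> fJ; have hX k' : Q ^+ k' != 0 by rewrite expf_neq0 // (lf_Q_neq0 lf).
apply: (mulfI (hX (m - rk AF J)%N)); rewrite -exprD subnK ?rk_le // mulr_sumr.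
transitivity (\sum_(t : {ffun 'I_m -> 'I_q}) 1 : R); last first.
  by rewrite sumr_const card_ffun !card_ord natrX.
rewrite [RHS](partition_big (Z J) (fun G => is_flat AF G && (G \subset J))) /=; last first.
  by move=> t _; rewrite residual_zeros_flat // residual_zeros_sub.
apply: eq_bigr => G /andP[fG GJ]; rewrite -card_residual_fibre // sumr_const.
by congr (_%:R); apply: eq_card => t; rewrite inE.
Qed.

(** As delta(G) >= rk(G), each term is at most chi(G, J), and these count all residue vectors. This
    is the weight estimate [chi_sum] for the resolvent. *)
Lemma sum_charpoly_rk J : is_flat AF J ->
  \sum_(G : {set 'I_n} | is_flat AF G && (G \subset J))
    charpoly_eval AF G J Q / Q ^+ delta AF G * Q ^+ rk AF G <= Q ^+ rk AF J.
Proof.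
move=> fJ; rewrite -sum_charpoly //; apply: ler_sum => G /andP[fG GJ].
rewrite -mulrA ler_piMr ?charpoly_ge0 // /delta exprD invfM divfK ?QinvX_le1 //.
by rewrite expf_neq0 // (lf_Q_neq0 lf).
Qed.

(** * The hypertoric integral *)

Lemma invmod_moment_ball k : invmod k (moment_ball k).
Proof.
move=> v w /intvP hv /intvP hw; rewrite /moment_ball; apply: eq_forallb => j.
rewrite -(nrm_addr_le lf (moment AF v 0 j)
  (y := moment AF (v + pi ^+ k *: w) 0 j - moment AF v 0 j)).
  by rewrite [X in _ = (nrm X <= _)]addrC subrK.
rewrite !mxE -sumrB; apply: (nrm_sum_le lf) => [|i _]; first exact: QinvX_ge0.
set a := lshift n i; set b := rshift n i.
rewrite !mxE; set p := pi ^+ k.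
have -> : (v 0 a + p * w 0 a) * (v 0 b + p * w 0 b) * AF i j - v 0 a * v 0 b * AF i j =
    p * ((v 0 a * w 0 b + w 0 a * v 0 b + p * (w 0 a * w 0 b)) * AF i j) by ring.
rewrite nrm_piX_mul_le (nrmM_le1 lf) // !(nrmD_le lf) ?(nrmM_le1 lf) //.
by rewrite nrm_piX QinvX_le1.
Qed.

Lemma moment_ballE k z : moment_ball k z = (vnorm nrm (moment AF z) <= Q ^- k).
Proof. by rewrite vnorm_leE ?QinvX_ge0. Qed.

Lemma vnorm_shell N (v : 'rV[F]_N) k :
  vnorm nrm v <= Q ^- k -> ~~ (vnorm nrm v <= Q ^- k.+1) -> vnorm nrm v = Q ^- k.
Proof.
move=> h1; rewrite vnorm_leE ?QinvX_ge0 // => /forallPn[j hj].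
apply/eqP; rewrite eq_le h1 /=; apply: (@le_trans _ _ (nrm (v 0 j))).
  by rewrite leNgt (nrm_discrete lf).
exact: (le_bigmax 0 (fun j => nrm (v 0 j)) j).
Qed.

Lemma vnorm_eq0 N (v : 'rV[F]_N) : (forall k, vnorm nrm v <= Q ^- k) -> vnorm nrm v = 0.
Proof.
move=> h; apply/eqP; rewrite eq_le bigmax_ge_id andbT vnorm_leE //; apply/forallP => j.
have [->|v0] := eqVneq (v 0 j) 0; first by rewrite (nrm0 lf).
have [z ez] := lf_value_group lf v0.
have := h `|z|%N.+1; rewrite vnorm_leE ?QinvX_ge0 // => /forallP/(_ j).
rewrite ez exprnN ler_eXz2l ?(lf_Q_gt1 lf) //; lia.
Qed.

Section Integral.
Local Open Scope classical_set_scope.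
Variables (mu : {measure set (Fvec nrm (n + n)) -> \bar R}) (s : R[i]).
Hypothesis haar : normalized_haar mu.
Hypothesis s_gt0 : 0 < complex.Re s.
Hypothesis rkT : rk AF [set: 'I_n]%SET = m.

Let u : R[i] := cpow Q (- s).
Let ratio : R := Q^-1 `^ complex.Re s.
Let vol k : R := Wcount k [set: 'I_n]%SET / Q ^+ m.
Let tail k : set (Fvec nrm (n + n)) := [set z | intv (z : 'rV[F]_(n + n)) /\ moment_ball k z].

Let mu_tail k : mu (tail k) = (vol k)%:E.
Proof. by rewrite (haar_count haar (@invmod_moment_ball k)) Wcount_vol. Qed.

Let measurable_tail k : measurable (tail k).
Proof.
apply: (@measurable_locally_invariant _ k) => v w [hv Pv] hw; split.
  by rewrite intvD // intv_piX.
by rewrite invmod_moment_ball.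
Qed.

Let tailS k : tail k.+1 `<=` tail k.
Proof.
move=> z [hz]; rewrite moment_ballE => h; split => //; rewrite moment_ballE.
apply: le_trans h _; rewrite exprS invfM ler_piMl ?QinvX_ge0 //.
exact/ltW/Qinv_lt1.
Qed.

Let intball_tail : intball nrm (n + n) = tail 0.
Proof.
apply/seteqP; split => z; rewrite /intball /tail /= vnorm_leE ?ler01 //.
  move=> hz; split => //; apply/forallP => j; rewrite expr0 invr1.
  by apply/intvP; exact: moment_int.
by case.
Qed.

Let vol_le1 k : vol k <= 1.
Proof.
rewrite -lee_fin -mu_tail -haar.2 intball_tail; apply: le_measure; rewrite ?inE //.
exact: (shell_sub tailS).
Qed.

Let ratioX k : (Q ^- k) `^ complex.Re s = ratio ^+ k.
Proof.
have Q0 : 0 <= Q^-1 by rewrite invr_ge0 ltW // (lf_Q_gt0 lf).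
rewrite -exprVn; elim: k => [|k IH]; first by rewrite !expr0 powR1.
by rewrite !exprS powRM ?exprn_ge0 // IH.
Qed.

Let ratio_lt1 : ratio < 1.
Proof.
have Qi0 : 0 < Q^-1 by rewrite invr_gt0 (lf_Q_gt0 lf).
rewrite /ratio /powR gt_eqF // expR_lt1 pmulr_rlt0 // ln_lt0 // Qi0.
exact: Qinv_lt1.
Qed.

Let norm_u : `|u| = ratio%:C%C.
Proof.
rewrite /u -cpow_inv ?(lf_Q_gt0 lf) // norm_cpow //.
by rewrite invr_gt0 (lf_Q_gt0 lf).
Qed.

(** [phi] stands for the real or the imaginary part, since the integral is defined separately on
    each. *)
Let part_approx (phi : R[i] -> R) K : phi 0 = 0 -> (forall z, `|phi z|%:C%C <= `|z|) ->
  `|Rintegral mu (intball nrm (n + n)) (fun z => phi (integrand nrm AF s z)) -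
    \sum_(k < K) phi (u ^+ k) * (vol k - vol k.+1)| <= ratio ^+ K.
Proof.
move=> phi0 phiM; rewrite intball_tail.
apply: (@le_trans _ _ (ratio ^+ K * vol K)); last first.
  by rewrite ler_piMr ?vol_le1 // exprn_ge0 // powR_ge0.
have Qi0 : 0 < Q^-1 by rewrite invr_gt0 (lf_Q_gt0 lf).
apply: (@shell_integral_approx _ _ _ mu tail vol (fun k => phi (u ^+ k)) (fun k => ratio ^+ k)) => //.
- move=> k z [hz]; rewrite moment_ballE => h1 h2.
  have {}h2 : ~~ (vnorm nrm (moment AF z) <= Q ^- k.+1).
    by apply/negP; rewrite -moment_ballE => h; apply: h2.
  rewrite /integrand (vnorm_shell h1 h2) -exprVn cpowX //.
  by rewrite cpow_inv // (lf_Q_gt0 lf).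
- move=> z hz; rewrite /integrand vnorm_eq0 => [|k]; first by rewrite /cpow eqxx.
  by rewrite -moment_ballE; case: (hz k).
- move=> k z [hz]; rewrite moment_ballE => h.
  rewrite -lecR; apply: le_trans (phiM _) _; rewrite -ratioX.
  by apply: norm_cpow_le => //; [exact: bigmax_ge_id|exact: ltW].
Qed.

Lemma hypertoric_integral_approx K :
  `|hypertoric_integral nrm AF mu s -
    \sum_(k < K) u ^+ k * (vol k - vol k.+1)%:C%C| <= 2 * ratio%:C%C ^+ K.
Proof.
rewrite sum_complexE /hypertoric_integral.
apply: le_trans (normc_le_add _ _) _.
rewrite mulr_natl -rmorphXn -rmorphMn /= lecR mulr2n lerD //.
  by apply: part_approx => // z; exact: normc_ge_Re.
by apply: part_approx => // z; exact: norm_Im_le.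
Qed.

Let resolv := resolvent (is_flat AF) (fun G J => charpoly_eval AF G J Q)
  (rk AF) (delta AF) Q u [set: 'I_n]%SET.

Lemma hypertoric_integral_resolvent :
  u * hypertoric_integral nrm AF mu s = (u - 1) * (resolv / (Q%:C)%C ^+ m) + 1.
Proof.
pose S K := \sum_(k < K) u ^+ k * (vol k)%:C%C.
pose B := \sum_G `|resolvent (is_flat AF) (fun G J => charpoly_eval AF G J Q)
  (rk AF) (delta AF) Q u G|.
(* Abel summation; the 1 is [vol 0]. *)
have HS K : u * (\sum_(k < K) u ^+ k * (vol k - vol k.+1)%:C%C) = u * S K - S K.+1 + 1.
  elim: K => [|K IH].
    rewrite /S big_ord_recr /= !big_ord0 mulr0 expr0 mul1r !add0r /vol Wcount0 rkT.
    by rewrite divff ?rmorph1 ?addNr // expf_neq0 // (lf_Q_neq0 lf).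
  rewrite big_ord_recr /= mulrDr IH /S big_ord_recr [in RHS]big_ord_recr /= rmorphB /=.
  by rewrite [in RHS]big_ord_recr /= !exprS; ring.
have QC0 k : (Q%:C)%C ^+ k != 0 :> R[i].
  by rewrite -rmorphXn fmorph_eq0 expf_neq0 // (lf_Q_neq0 lf).
have SZ K : `|S K - resolv / (Q%:C)%C ^+ m| <= B * ratio%:C%C ^+ K.
  have := @resolvent_approx R n (is_flat AF) (fun G J => charpoly_eval AF G J Q)
    (rk AF) (delta AF) Q u Wcount (lf_Q_gt1 lf) _ _ _ _ Wcount0 WcountS [set: 'I_n]%SET K (flatT AF).
  rewrite -/B rkT norm_u distrC => h.
  have -> : S K - resolv / (Q%:C)%C ^+ m =
     (\sum_(k < K) u ^+ k * (Wcount k [set: 'I_n]%SET)%:C%C - resolv) / (Q%:C)%C ^+ m.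
    rewrite mulrBl mulr_suml; congr (_ - _); apply: eq_bigr => k _.
    by rewrite /vol rmorphM fmorphV rmorphXn /= mulrA.
  have normQ : `|(Q%:C)%C| = (Q%:C)%C :> R[i].
    by rewrite ger0_norm // ler0c ltW // (lf_Q_gt0 lf).
  rewrite normrM normfV normrX normQ.
  rewrite ler_pdivrMr; last by rewrite exprn_gt0 // ltcR (lf_Q_gt0 lf).
  apply: h.
  - by rewrite -[1]/(1%:C%C) ltcR ratio_lt1.
  - by move=> G J fG fJ GJ; exact: charpoly_ge0.
  - by move=> J fJ; exact: charpoly_diag.
  - exact: sum_charpoly_rk.
apply/eqP; rewrite -subr_eq0; apply/eqP.
(* The 2 comes from the integral, one [B] from [S K] and one from [S K.+1]; each error carries a
   factor |u|. *)
apply: (@eq0_geometric_bound _ _ (ratio%:C%C * (2 + B + B)) ratio).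
  by rewrite powR_ge0 ratio_lt1.
move=> K; set I := hypertoric_integral _ _ _ _; set z := resolv / _.
set H := \sum_(k < K) u ^+ k * (vol k - vol k.+1)%:C%C.
have -> : u * I - ((u - 1) * z + 1) = u * (I - H) + (u * (S K - z) - (S K.+1 - z)).
  by rewrite mulrBr HS; ring.
apply: le_trans (ler_normD _ _) _.
have -> : ratio%:C%C * (2 + B + B) * ratio%:C%C ^+ K =
    ratio%:C%C * (2 * ratio%:C%C ^+ K) +
    (ratio%:C%C * (B * ratio%:C%C ^+ K) + B * ratio%:C%C ^+ K.+1) by rewrite exprS; ring.
have r0 : 0 <= ratio%:C%C :> R[i] by rewrite ler0c powR_ge0.
rewrite lerD //; first by rewrite normrM norm_u ler_wpM2l // hypertoric_integral_approx.
apply: le_trans (ler_normB _ _) _.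
by rewrite lerD // normrM norm_u ler_wpM2l.
Qed.
End Integral.
End GoodReduction.
End Representatives.

(** * Minors as units *)

Lemma charpoly_eval_rmorph (F : fieldType) (n m : nat) (AF : 'M[F]_(n, m))
    (S T : comPzRingType) (h : {rmorphism S -> T}) G J t :
  charpoly_eval AF G J (h t) = h (charpoly_eval AF G J t).
Proof.
by rewrite rmorph_sum; apply: eq_bigr => H _; rewrite rmorphM rmorph_int rmorphXn.
Qed.

Section Reduction.
Variables (R : realType) (F : fieldType) (nrm : F -> R) (q : nat).
Hypothesis lf : normalized_local_field nrm q.

(** The given representatives are changed so that the class of the maximal ideal is represented by
    [0] itself. *)
Lemma residue_section : exists (r : 'I_q -> F) (red : F -> 'I_q),
  [/\ forall i, nrm (r i) <= 1,
      forall i, nrm (r i) < 1 -> r i = 0,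
      forall i j, i != j -> nrm (r i - r j) = 1 &
      forall x, nrm x <= 1 -> nrm (x - r (red x)) < 1].
Proof.
have [r [r1 r2 r3]] := lf_residue lf.
pose r' i := if nrm (r i) < 1 then 0 else r i.
have r_unit i : (nrm (r i) < 1) = false -> nrm (r i) = 1.
  by move=> h; apply/eqP; rewrite eq_le r1 leNgt h.
have /choice[red hred] : forall x, exists i, nrm x <= 1 -> nrm (x - r' i) < 1.
  move=> x; have [/r3[i hi]|_] := boolP (nrm x <= 1); last first.
    by exists (Ordinal (ltnW (lf_q_gt1 lf))).
  exists i => _; rewrite /r'; case: ifP => // h.
  by rewrite subr0 -(subrK (r i) x) (nrmD_lt lf).
exists r', red; split => // [i|i|i j ij]; rewrite /r'.
- by case: ifP => _; rewrite ?(nrm0 lf) ?ler01.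
- by case: ifP => // ->.
have := r2 _ _ ij; case: ifP => hi; case: ifP => hj e.
- suff : nrm (r i - r j) < 1 by rewrite e ltxx.
  by rewrite (nrmD_lt lf) ?(nrmN lf).
- by rewrite sub0r (nrmN lf) r_unit.
- by rewrite subr0 r_unit.
- exact: e.
Qed.

(** A prime factor of [N] is at most [N], so by hypothesis its norm is not below 1; multiply over
    the factorization. *)
Lemma nrm_nat_unit N : (0 < N)%N ->
  (forall p, prime p -> nrm p%:R < 1 -> (N < p)%N) -> nrm N%:R = 1.
Proof.
move=> N0 h.
have hp p : prime p -> (p %| N)%N -> nrm p%:R = 1.
  move=> pp pN; apply/eqP; rewrite eq_le (nrm_nat_le1 lf) leNgt; apply/negP.
  by move/(h p pp); rewrite ltnNge dvdn_leq.
elim/ltn_ind: N N0 hp {h} => N IH N0 hp.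
have [N1|N1] := leqP N 1%N.
  have -> : N = 1%N by apply/eqP; rewrite eqn_leq N1.
  exact: nrm1 lf.
have pN := pdiv_dvd N; have ppN := pdiv_prime N1.
rewrite -(divnK pN) natrM (lf_nrmM lf) (hp (pdiv N)) // mulr1 IH //.
- by rewrite ltn_Pdiv // prime_gt1.
- by rewrite divn_gt0 ?prime_gt0 // dvdn_leq.
- by move=> p pp /dvdn_trans h; apply: hp => //; apply: h; exact: dvdn_div.
Qed.

Lemma nrm_int_unit (z : int) : z != 0 ->
  (forall p : nat, prime p -> nrm p%:R < 1 -> `|z| < p%:Z) -> nrm z%:~R = 1.
Proof.
move=> z0 h; have -> : nrm z%:~R = nrm (`|z|%N)%:R.
  by case: z {z0 h} => k //; rewrite NegzE mulrNz (nrmN lf).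
apply: nrm_nat_unit => [|p pp hp]; first by rewrite absz_gt0.
by have := h p pp hp; lia.
Qed.

Variables (n m : nat) (A : 'M[int]_(n, m)).
Hypothesis small_minors : forall p : nat, prime p -> nrm (p%:R : F) < 1 ->
  forall k (f : 'I_k.+1 -> 'I_n) (g : 'I_k.+1 -> 'I_m), `|minor A f g| < p%:Z.
Local Notation AF := (map_mx (fun z : int => z%:~R) A : 'M[F]_(n, m)).

Lemma nrm_minor k (f : 'I_k -> 'I_n) (g : 'I_k -> 'I_m) :
  \det (\matrix_(i, j) A (f i) (g j)) != 0 ->
  nrm (\det (\matrix_(i, j) AF (f i) (g j))) = 1.
Proof.
have -> : \det (\matrix_(i, j) AF (f i) (g j)) = (\det (\matrix_(i, j) A (f i) (g j)))%:~R.
  by rewrite -det_map_mx; congr (\det _); apply/matrixP => i j; rewrite !mxE.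
(* [minor] begins at size one; the empty minor is 1. *)
case: k f g => [|k] f g h; first by rewrite det_mx00 (nrm1 lf).
by apply: nrm_int_unit => // p pp hp; exact: small_minors.
Qed.

Lemma map_minor_neq0 (K : fieldType) k (f : 'I_k -> 'I_n) (g : 'I_k -> 'I_m) :
  \det (\matrix_(i, j) (map_mx (fun z : int => z%:~R : K) A) (f i) (g j)) != 0 ->
  \det (\matrix_(i, j) A (f i) (g j)) != 0.
Proof.
apply: contraNneq => e.
have -> : (\matrix_(i, j) (map_mx (fun z : int => z%:~R : K) A) (f i) (g j)) =
  map_mx intr (\matrix_(i, j) A (f i) (g j)) by apply/matrixP => i j; rewrite !mxE.
by rewrite det_map_mx e rmorph0.
Qed.

(** A nonzero maximal minor over the rationals is a nonzero integer, hence a unit in [F], so the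
    rank survives the change of field. *)
Lemma rk_spanning : \rank (map_mx (fun z : int => z%:~R : rat) A) = m ->
  rk AF [set: 'I_n] = m.
Proof.
move=> hr; have fA : row_full (map_mx (fun z : int => z%:~R : rat) A).
  by rewrite /row_full hr.
have := fullrowsub_unit fA; rewrite unitmxE unitfE => h.
have d0 : \det (\matrix_(i, j) AF (fullrankfun fA i) j) != 0.
  apply/eqP => e.
  have := @nrm_minor _ (fullrankfun fA) id; rewrite e (nrm0 lf) => h'.
  have /h'/eqP : \det (\matrix_(i, j) A (fullrankfun fA i) (id j)) != 0.
    apply: (@map_minor_neq0 rat); apply: contraNneq h => <-.
    by apply/eqP; congr (\det _); apply/matrixP => i j; rewrite !mxE.
  by rewrite eq_sym oner_eq0.
apply/eqP; rewrite eqn_leq rk_le /= /rk.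
have -> : rowsJ AF [set: 'I_n] = AF by apply/matrixP => i j; rewrite mxE inE.
have : \matrix_(i, j) AF (fullrankfun fA i) j \in unitmx by rewrite unitmxE unitfE.
move/mxrank_unit => {1}<-; apply: mxrankS.
have -> : \matrix_(i, j) AF (fullrankfun fA i) j = rowsub (fullrankfun fA) AF.
  by apply/matrixP => i j; rewrite !mxE.
by rewrite rowsubE submxMl.
Qed.

End Reduction.

(** * Assembly of the formula *)

Local Open Scope complex_scope.
Local Open Scope classical_set_scope.

Theorem mainTheorem3 (R : realType) (F : fieldType) (nrm : F -> R) (q : nat)
    (n m : nat) (A : 'M[int]_(n, m))
    (mu : {measure set (Fvec nrm (n + n)) -> \bar R}) (s : R[i]) :
  normalized_local_field nrm q ->
  normalized_haar mu ->
  (* a_1, ..., a_n span Q^m *)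
  \rank (map_mx (fun z : int => z%:~R : rat) A) = m ->
  (* the residue characteristic exceeds |minor| for every minor of A *)
  (forall p : nat, prime p -> nrm (p%:R : F) < 1 ->
     forall k (f : 'I_k.+1 -> 'I_n) (g : 'I_k.+1 -> 'I_m),
       `|minor A f g| < p%:Z) ->
  0 < complex.Re s ->
  let AF : 'M[F]_(n, m) := map_mx (fun z : int => z%:~R) A in
  let Q : R := q%:R in
  let QC : R[i] := Q%:C in
  hypertoric_integral nrm AF mu s =
    (QC ^+ m - 1) / (QC ^+ m - cpow Q (- s))
    + (1 - cpow Q s) / (1 - cpow Q (- (s + m%:R)))
      * \sum_(1 <= r < n.+1)
          \sum_(c : r.-tuple {set 'I_n} | is_chain AF c)
            let I := fun k => nth [set: 'I_n]%SET ([set: 'I_n]%SET :: c) k in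
            (Q^-1 ^+ (m - rk AF (I r)))%:C
            * \prod_(k < r)
                (charpoly_eval AF (I k.+1) (I k) QC
                 / (cpow Q (s + (delta AF (I k.+1))%:R) - 1)).
Proof.
move=> lf haar hrank hmin s0 AF Q QC.
have [pi nrm_pi] := lf_uniformizer lf.
have [r [red [r_le1 r_lt1 r_sep redP]]] := residue_section lf.
have AF_int i j : nrm (AF i j) <= 1 by rewrite mxE; exact: nrm_int_le1 lf _.
have AF_minor k (f : 'I_k -> 'I_n) (g : 'I_k -> 'I_m) :
    \det (\matrix_(i, j) AF (f i) (g j)) != 0 ->
    nrm (\det (\matrix_(i, j) AF (f i) (g j))) = 1.
  by move/map_minor_neq0; exact: (nrm_minor lf hmin).
have rkT : rk AF [set: 'I_n]%SET = m := rk_spanning lf hmin hrank.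
have := hypertoric_integral_resolvent lf nrm_pi r_le1 r_lt1 r_sep redP AF_int AF_minor
  haar s0 rkT.
rewrite -/Q -/QC.
set I := hypertoric_integral _ _ _ _; set u := cpow Q (- s) => hI.
have Q0 : 0 < Q := lf_Q_gt0 lf.
have u0 : u != 0 by exact: cpow_neq0.
have es : cpow Q s = u^-1 by rewrite -cpowN // opprK.
have u1 : `|u| < 1.
  rewrite norm_cpow // -[1]/(1%:C) ltcR /powR gt_eqF // expR_lt1.
  case: (s) s0 => x y /= x0.
  by rewrite mulNr oppr_lt0 mulr_gt0 // ln_gt0 // (lf_Q_gt1 lf).
have QCu k : QC ^+ k - u != 0 by exact: Qpow_neq_u (lf_Q_gt1 lf) u1 k.
have QC0 k : QC ^+ k != 0 by exact: QC_neq0 (lf_Q_gt1 lf) k.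
have deltaT : delta AF [set: 'I_n]%SET = m.
  by rewrite /delta rkT cardsT card_ord subnn.
set Sigma := \sum_(1 <= r < n.+1) _.
(* The 1 is the chain of length zero, which the sum of the theorem omits. *)
have eSigma : chain_sum (is_flat AF) (fun G J => charpoly_eval AF G J Q)
    (rk AF) (delta AF) Q u [set: 'I_n]%SET = QC ^+ m * (1 + Sigma).
  rewrite /chain_sum big_ord_recl chain_sum_len0 rkT mulrDr mulr1; congr (_ + _).
  rewrite /Sigma big_add1 /= big_mkord mulr_sumr; apply: eq_bigr => i _.
  rewrite mulr_sumr; apply: eq_bigr => c _ /=.
  rewrite mulrA; congr (_ * _).
    have e J : QC ^+ rk AF J = QC ^+ m * (Q^-1 ^+ (m - rk AF J))%:C.
      rewrite -[in QC ^+ m](subnK (rk_le AF J)) exprD mulrAC rmorphXn fmorphV /=.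
      by rewrite -exprMn divff ?expr1n ?mul1r // -[QC]expr1.
    exact: e.
  apply: eq_bigr => k _; rewrite /chain_weight cpowD // es cpow_nat //.
  rewrite (charpoly_eval_rmorph _ (real_complex R)) -/QC; congr (_ * _).
  have e x : u^-1 * x - 1 = (x - u) / u by rewrite mulrBl divff // mulrC.
  by rewrite e invf_div.
move: hI; rewrite /resolvent eSigma deltaT opprD cpowD // (cpowN m%:R) // cpow_nat // -/u => hI.
(* The length-zero chain yields u^-1 + (1 - u^-1) q^m / (q^m - u) = (q^m - 1) / (q^m - u), the
   isolated first fraction. *)
apply: (mulfI u0); rewrite hI es.
by field; rewrite u0 QCu QC0.
Qed.
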